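(* Let $m>0$ and let $\Sigma$ be a smooth spacelike graph $t=u(r,\mathbf y)$ of a bounded function $u$ inside Region I (i.e. $r>2m$) of the Kruskal extension of Schwarzschild spacetime, such that $\Sigma$ can be extended to be a smooth spacelike surface near $T=X=0$ so that $T$ is a smooth function of $X,\mathbf y$ on it. Then $u$ is smooth at $\eta=0$ as a function of $(\eta,\mathbf y)$, where $\eta=\left(1-\frac{2m}{r}\right)^{\frac12}$.
   Context: $\mathbf y\in\mathbb S^2$ (unit sphere, standard metric $\sigma$). The Kruskal extension has coordinates $(T,X,\mathbf y)$ and metric $\frac{32m^3}{r}\exp(-\frac r{2m})(-dT^2+dX^2)+r^2\sigma$, where $r=r(T,X)$ is given by $X^2-T^2=(\frac r{2m}-1)\exp(\frac r{2m})$. Region I is $X>0$, $X^2-T^2>0$ (so $r>2m$); there the metric is $g_{\mathrm{Sch}}=-(1-\frac{2m}r)dt^2+(1-\frac{2m}r)^{-1}dr^2+r^2\sigma$ with $T=(\frac r{2m}-1)^{1/2}e^{r/4m}\sinh\frac t{4m}$, $X=(\frac r{2m}-1)^{1/2}e^{r/4m}\cosh\frac t{4m}$. The function $u$ is defined for $r>2m$ close to $2m$ and all $\mathbf y\in\mathbb S^2$; since $u$ is bounded, $X\to0$ on $\Sigma$ if and only if $r\to2m$, i.e. $\eta\to0$. *)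

(* Defs.v *)
From HB Require Import structures.
From mathcomp Require Import all_boot all_order all_algebra.
From mathcomp Require Import all_classical all_reals all_analysis.
From mathcomp Require Import ring lra.

Set Implicit Arguments.
Unset Strict Implicit.
Unset Printing Implicit Defensive.

Import Order.TTheory GRing.Theory Num.Theory.
Import numFieldNormedType.Exports.

Local Open Scope classical_set_scope.
Local Open Scope ring_scope.

Section Smoothness.
Context {R : realType} {V : normedModType R}.
Implicit Types (k : nat) (U A : set V) (f : V -> R).

(* Meant for V finite-dimensional and U open, where it says that all directional
   derivatives of f of order at most k exist and are continuous on U. *)
Fixpoint class_C k U f : Prop :=
  match k with
  | 0 => forall x, U x -> {for x, continuous f}
  | k'.+1 => (forall x, U x -> differentiable f x) /\
             (forall v : V, class_C k' U ('D_v f))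
  end.

(* Smoothness on an arbitrary subset: local extendability to a smooth function on
   an open set of the ambient space. For I `*` sphere2 this is smoothness on the
   manifold I x S^2, up to the boundary if I is a half-open interval. *)
Definition smooth_on A f : Prop :=
  forall a, A a -> exists (U : set V) (F : V -> R),
    [/\ open U, U a, forall k, class_C k U F &
        forall x, U x -> A x -> F x = f x].

End Smoothness.

Section Kruskal.
Context {R : realType}.

Definition dotr (v w : 'rV[R]_3) : R := \sum_(i < 3) v 0 i * w 0 i.

Definition sphere2 : set 'rV[R]_3 := [set y | dotr y y = 1].

(* Ambient space R x R x R^3 of the Kruskal coordinates ((T, X), y). *)
Definition kcoord : normedModType R := ((R * R)%type * 'rV[R]_3)%type.

Definition kruskal : set kcoord :=
  [set p | -1 < p.1.2 ^+ 2 - p.1.1 ^+ 2 /\ sphere2 p.2].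

Definition region_I : set kcoord :=
  [set p | [/\ 0 < p.1.2, 0 < p.1.2 ^+ 2 - p.1.1 ^+ 2 & sphere2 p.2]].

(* r(T, X), uniquely determined when X^2 - T^2 > -1 (and 0 otherwise). *)
Definition area_radius (m T X : R) : R :=
  xget 0 [set r | 0 < r /\
    X ^+ 2 - T ^+ 2 = (r / (2 * m) - 1) * expR (r / (2 * m))].

(* The Kruskal metric at p. On vectors (dT, dX, w) with w orthogonal to p.2, the
   Euclidean product dotr is the standard metric of S^2. *)
Definition kruskal_metric (m : R) (p v w : kcoord) : R :=
  let r := area_radius m p.1.1 p.1.2 in
  32 * m ^+ 3 / r * expR (- (r / (2 * m))) *
    (- (v.1.1 * w.1.1) + v.1.2 * w.1.2)
  + r ^+ 2 * dotr v.2 w.2.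

(* v is the velocity at p of a curve lying in S; when S is an embedded
   submanifold these vectors form its tangent space at p. *)
Definition tangent_to (S : set kcoord) (p v : kcoord) : Prop :=
  exists c : R -> kcoord,
    [/\ c 0 = p, is_derive (0 : R) (1 : R) c v & \forall s \near (0 : R), S (c s)].

Definition spacelike (m : R) (S : set kcoord) : Prop :=
  forall p v, S p -> tangent_to S p v -> v != 0 -> 0 < kruskal_metric m p v v.

Definition sinhR (x : R) : R := (expR x - expR (- x)) / 2.
Definition coshR (x : R) : R := (expR x + expR (- x)) / 2.

Definition region_I_embedding (m t r : R) (y : 'rV[R]_3) : kcoord :=
  let a := Num.sqrt (r / (2 * m) - 1) * expR (r / (4 * m)) in
  ((a * sinhR (t / (4 * m)), a * coshR (t / (4 * m))), y).

Definition graph_domain (m r1 : R) : set (R * 'rV[R]_3)%type :=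
  [set r | 2 * m < r < r1] `*` sphere2.

Definition schwarzschild_graph (m r1 : R) (u : R * 'rV[R]_3 -> R) : set kcoord :=
  [set region_I_embedding m (u p) p.1 p.2 | p in graph_domain m r1].

Definition kruskal_graph (eps : R) (tau : R * 'rV[R]_3 -> R) : set kcoord :=
  [set ((tau p, p.1), p.2) | p in [set X : R | `|X| < eps] `*` sphere2].

(* Sigma extends to a smooth spacelike surface near T = X = 0 on which T is a
   smooth function of (X, y): in Region I, points of Sigma close to T = X = 0 are
   exactly those with X small, since |T| < X there. *)
Definition extends_through_bifurcation (m : R) (Sigma : set kcoord) : Prop :=
  exists (eps : R) (tau : R * 'rV[R]_3 -> R),
    [/\ 0 < eps,
        smooth_on ([set X : R | `|X| < eps] `*` sphere2) tau,
        kruskal_graph eps tau `<=` kruskal,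
        spacelike m (kruskal_graph eps tau) &
        Sigma `&` [set p | p.1.2 < eps] `<=` kruskal_graph eps tau].

Definition eta_coord (m r : R) : R := Num.sqrt (1 - 2 * m / r).

Lemma region_I_embeddingP (m t r : R) (y : 'rV[R]_3) :
    0 < m -> 2 * m < r -> sphere2 y ->
  let p := region_I_embedding m t r y in
  region_I p /\ area_radius m p.1.1 p.1.2 = r.
Proof.
move=> m0 mr Sy /=.
have m2 : 0 < 2 * m by rewrite mulr_gt0.
have r0 : 0 < r by exact: lt_trans mr.
have x1 : 1 < r / (2 * m) by rewrite ltr_pdivlMr // mul1r.
set x := r / (2 * m) in x1 *.
have xE : expR (r / (4 * m)) ^+ 2 = expR x.
  rewrite expr2 -expRD /x; congr expR; field.
  by rewrite gt_eqF.
rewrite /region_I_embedding -/x.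
set a := Num.sqrt (x - 1) * expR (r / (4 * m)).
have aE : a ^+ 2 = (x - 1) * expR x.
  by rewrite /a exprMn xE sqr_sqrtr // subr_ge0 ltW.
have a0 : 0 < a by rewrite mulr_gt0 ?expR_gt0 // sqrtr_gt0 subr_gt0.
set s := t / (4 * m).
have csE : (a * coshR s) ^+ 2 - (a * sinhR s) ^+ 2 = (x - 1) * expR x.
  have e1 : expR s * expR (- s) = 1 by rewrite -expRD subrr expR0.
  have key (b c d : R) :
      (b * ((c + d) / 2)) ^+ 2 - (b * ((c - d) / 2)) ^+ 2 = b ^+ 2 * (c * d).
    by field.
  by rewrite /coshR /sinhR key e1 mulr1 aE.
have fmono (z w : R) : 0 < z -> z < w -> (z - 1) * expR z < (w - 1) * expR w.
  move=> z0 zw.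
  have [w1|w1] := leP 1 w.
    have [z1|z1] := leP 1 z.
      rewrite (le_lt_trans (y := (z - 1) * expR w)) //.
        by rewrite ler_wpM2l ?subr_ge0 // ler_expR ltW.
      by rewrite ltr_pM2r ?expR_gt0 // ltrD2r.
    rewrite (lt_le_trans (y := 0)) //.
      by rewrite pmulr_llt0 ?expR_gt0 // subr_lt0.
    by rewrite mulr_ge0 ?expR_ge0 ?subr_ge0.
  have h := expR_ge1Dx (z - w).
  have -> : expR z = expR (z - w) * expR w by rewrite -expRD subrK.
  rewrite mulrA ltr_pM2r ?expR_gt0 //.
  rewrite (le_lt_trans (y := (z - 1) * (1 + (z - w)))) //; last by nra.
  by rewrite ler_wnM2l // subr_le0 ltW // (lt_trans zw).
split.
  split=> //=; last by rewrite csE mulr_gt0 ?expR_gt0 // subr_gt0.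
  by rewrite mulr_gt0 // mulr_gt0 ?invr_gt0 // addr_gt0 ?expR_gt0.
rewrite /area_radius; apply: xget_subset1; first by rewrite /= csE.
move=> r' r'' /= [r'0 e'] [r''0 e''].
have {}e' : r' / (2 * m) = r'' / (2 * m).
  apply/eqP; rewrite eq_le !leNgt; apply/andP; split; apply/negP => lt.
    have := fmono _ _ (divr_gt0 r''0 m2) lt.
    by rewrite -e' -e'' ltxx.
  have := fmono _ _ (divr_gt0 r'0 m2) lt.
  by rewrite -e' -e'' ltxx.
by apply: (mulIf _ e'); rewrite invr_neq0 // gt_eqF.
Qed.

Corollary schwarzschild_graph_region_I (m r1 : R) (u : R * 'rV[R]_3 -> R) :
  0 < m -> schwarzschild_graph m r1 u `<=` region_I.
Proof.
move=> m0 _ [p [/= /andP[mr _] Sp] <-].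
by have [] := region_I_embeddingP (u p) m0 mr Sp.
Qed.

End Kruskal.

(* Main.v *)
Require Import Defs.
From HB Require Import structures.
From mathcomp Require Import all_boot all_order all_algebra.
From mathcomp Require Import all_classical all_reals all_analysis.
From mathcomp Require Import ring lra.

Set Implicit Arguments.
Unset Strict Implicit.
Unset Printing Implicit Defensive.

Import Order.TTheory GRing.Theory Num.Theory.
Import numFieldNormedType.Exports.

Local Open Scope classical_set_scope.
Local Open Scope ring_scope.

(** Let [a = sqrt (X^2 - T^2)]. In Region I it depends on [eta] alone, through a
    function that is smooth across [eta = 0] and vanishes there, and the points of
    the surface are [T = a sinh (t / 4m)], [X = a cosh (t / 4m)] with
    [t = u (r, y)]. The extended surface is [T = tau (X, y)] with [tau] smooth, and
    the claim is that [t] can be solved for smoothly in terms of [(a, y)].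

    Since [|u| <= C], every point of the surface satisfies [|T| <= k X] with
    [k = tanh (C / 4m) < 1], and [X] tends to [0] with [eta]. Hence
    [tau (0, y) = 0], so [tau (X, y) = X h (X, y)] with [h] smooth ([hadamard]), and
    [|h (0, y)| <= k < 1] ([slope_extension]). On the surface [h = tanh (t / 4m)]
    and [a = X sqrt (1 - h^2)]. The [X]-derivative of the right-hand side at
    [X = 0] is [sqrt (1 - h (0, y)^2) > 0], so [X] is a smooth function of [(a, y)]
    ([smooth_local_inverse]), and so is [t = 4m artanh (h (X, y))]
    ([rapidity_extension]). Substituting [a = hyperbolic_radius eta] gives a smooth
    function of [(eta, y)] defined on both sides of [eta = 0], which agrees with [u]
    where [eta > 0] ([local_extension]).

    Smoothness on the sphere is defined by local extension to the ambient space.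
    All the analysis therefore takes place on open subsets of [R * W], for an
    arbitrary normed module [W], and the sphere enters only as a set of parameter
    values. The extensions found near different points [(0, y0)] are unrelated off
    the sphere; they are glued by defining [U (0, y)] as the limit of [u] as [eta]
    tends to [0] from the right. *)

(** * Differentiability at a point *)

Section Calculus.
Context {R : realType} {V : normedModType R}.
Implicit Types (f g : V -> R) (U : set V) (k : nat).

Lemma is_diff_of_littleo f x : f x = 0 ->
  (forall e : R, 0 < e -> \forall z \near x, `|f z| <= e * `|z - x|) ->
  is_diff x f 0.
Proof.
move=> fx0 fo.
have dE : f \o shift x = cst (f x) + \0 +o_ 0 id.
  apply/eqaddoP => e e0; rewrite fx0.
  have := fo e e0; rewrite (near_shift 0) => fe.
  near=> h; rewrite !fctE /= addr0 subr0.
  have -> : `|h| = `|(h + (x - 0)) - x| by rewrite subr0 addrK.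
  by rewrite -[X in f (h + X)](subr0 x); near: h.
have c0 : continuous (\0 : V -> R) by exact: cst_continuous.
have d0 : 'd f x = 0 :> (V -> R) by exact: diff_unique dE.
by apply: DiffDef => //; apply/diff_locallyP; rewrite d0.
Unshelve. all: by end_near. Qed.

Lemma near_is_diff f g (df : V -> R) x : {near x, f =1 g} ->
  is_diff x f df -> is_diff x g df.
Proof.
move=> fg dfx.
have -> : g = f + (g - f) by apply/funext => z; rewrite !fctE addrC subrK.
have fgx : f x = g x by exact: (nbhs_singleton fg).
have h : is_diff x (g - f) 0.
  apply: is_diff_of_littleo; first by rewrite !fctE fgx subrr.
  move=> e e0; near=> z.
  have fgz : f z = g z by near: z.
  by rewrite !fctE fgz subrr normr0 mulr_ge0 // ltW.
by rewrite -[df]addr0; exact: is_diffD.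
Unshelve. all: by end_near. Qed.

Lemma is_diff_derive f (df : V -> R) x v : is_diff x f df -> 'D_v f x = df v.
Proof. by move=> dfx; rewrite deriveE // diff_val. Qed.

Lemma differentiable_locally_lipschitz f x : differentiable f x ->
  exists2 M : R, 0 < M & \forall z \near x, `|f z - f x| <= M * `|z - x|.
Proof.
move=> dfx.
have /linear_lipschitz [M M0 HM] : continuous ('d f x) by exact: diff_continuous.
have /eqaddoP /(_ 1 ltr01) := diff_locally dfx.
rewrite [X in X -> _](near_shift x) => H; exists (M + 1); first by rewrite addr_gt0.
near=> z.
have : `|f z - f x - 'd f x (z - x)| <= 1 * `|z - x|.
  near: z; apply: filterS H => z /=.
  by rewrite !fctE /= sub0r subrK opprD addrA.
have := HM (z - x); have := ler_normD (f z - f x - 'd f x (z - x)) ('d f x (z - x)).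
rewrite subrK; nra.
Unshelve. all: by end_near. Qed.

(** The factor [l] is already [O(z - x)], so only the value [k x] of the other
    factor enters at first order: continuity of [k] suffices. This is how both
    the inverse function and the quotient by the first variable are shown to be
    differentiable, from factorizations whose second factor is a difference
    quotient not yet known to be better than continuous. *)
Lemma is_diff_vanishing_mul (l k : V -> R) (dl : V -> R) x :
  is_diff x l dl -> l x = 0 -> {for x, continuous k} ->
  is_diff x (l * k) (k x *: dl).
Proof.
move=> dlx lx0 kc.
have -> : l * k = k x *: l + l * (fun z => k z - k x).
  by apply/funext => z; rewrite !fctE [_ *: _]mulrC -mulrDr addrC subrK.
rewrite -[k x *: dl]addr0; apply: is_diffD; apply: is_diff_of_littleo.
  by rewrite !fctE lx0 mul0r.
move=> e e0.
have [|M M0 HM] := @differentiable_locally_lipschitz l x; first by [].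
near=> z; rewrite !fctE normrM.
have h1 : `|l z| <= M * `|z - x|.
  by rewrite -[l z]subr0 -lx0; near: z.
have h2 : `|k z - k x| <= e / M.
  near: z; have /cvgrPdist_le /(_ (e / M)) := kc.
  by rewrite divr_gt0 // => /(_ isT); apply: filterS => z; rewrite distrC.
rewrite (le_trans (ler_pM _ _ h1 h2)) //.
by rewrite mulrAC mulrCA mulfV ?gt_eqF // mulr1.
Unshelve. all: by end_near. Qed.
End Calculus.

(** * Calculus of functions of class C^k *)

Section ClassC.
Context {R : realType} {V : normedModType R}.
Implicit Types (f g : V -> R) (U : set V) (k : nat).

Lemma class_C_sub k U U' f : U' `<=` U -> class_C k U f -> class_C k U' f.
Proof.
elim: k f => [|k IH] f UU' /=; first by move=> fc x /UU'; exact: fc.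
by move=> [df Cf]; split=> [x /UU'|v]; [exact: df|exact: IH].
Qed.

Lemma class_CS k U f : class_C k.+1 U f -> class_C k U f.
Proof.
elim: k f => [|k IH] f [df Cf].
  by move=> x Ux; exact/differentiable_continuous/df.
by split=> // v; apply: IH.
Qed.

Lemma class_C_differentiable k U f x :
  class_C k.+1 U f -> U x -> differentiable f x.
Proof. by move=> [df _]; exact: df. Qed.

Lemma class_C_derive k U f v : class_C k.+1 U f -> class_C k U ('D_v f).
Proof. by move=> [_ Cf]; exact: Cf. Qed.

Lemma class_C_eq k U f g : open U -> (forall x, U x -> f x = g x) ->
  class_C k U f -> class_C k U g.
Proof.
move=> Uo.
have nfg (h l : V -> R) x : (forall x, U x -> h x = l x) -> U x -> {near x, h =1 l}.
  move=> hl Ux; apply: (filterS (P := U)) => [z|]; first exact: hl.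
  exact: open_nbhs_nbhs.
elim: k f g => [|k IH] f g fg /=.
  move=> fc x Ux; have e := nfg f g x fg Ux.
  rewrite /prop_for /continuous_at -(fg _ Ux).
  by apply: cvg_trans (fc x Ux); exact: near_eq_cvg.
move=> [df Cf]; split=> [x Ux|v].
  have dfx := differentiableP (df x Ux).
  by have := near_is_diff (nfg f g x fg Ux) dfx.
apply: IH (Cf v) => x Ux.
by apply: near_eq_derive; exact: nfg Ux.
Qed.

Lemma class_C_cst k U (c : R) : class_C k U (cst c).
Proof.
elim: k c => [|k IH] c /=; first by move=> x _; exact: cst_continuous.
split=> [x _|v]; first exact: differentiable_cst.
have -> : 'D_v (cst c) = cst 0 :> (V -> R) by apply/funext => x; rewrite derive_cst.
exact: IH.
Qed.

Lemma class_CD k U f g : open U ->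
  class_C k U f -> class_C k U g -> class_C k U (f + g).
Proof.
move=> Uo; elim: k f g => [|k IH] f g /=.
  by move=> fc gc x Ux; apply: continuousD; [exact: fc|exact: gc].
move=> [df Cf] [dg Cg]; split=> [x Ux|v].
  by apply: differentiableD; [exact: df|exact: dg].
apply: class_C_eq Uo _ (IH _ _ (Cf v) (Cg v)) => x Ux.
by rewrite deriveD //; apply: diff_derivable; [exact: df|exact: dg].
Qed.

Lemma class_CM k U f g : open U ->
  class_C k U f -> class_C k U g -> class_C k U (f * g).
Proof.
move=> Uo; elim: k f g => [|k IH] f g.
  by move=> fc gc x Ux; apply: continuousM; [exact: fc|exact: gc].
move=> Cf Cg.
have df := class_C_differentiable Cf; have dg := class_C_differentiable Cg.
split=> [x Ux|v].
  by apply: differentiableM; [exact: df|exact: dg].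
apply: (@class_C_eq _ _ (f * 'D_v g + g * 'D_v f)) => //.
  move=> x Ux.
  by rewrite deriveM //; apply: diff_derivable; [exact: df|exact: dg].
have [Cf' Cg'] := (class_CS Cf, class_CS Cg).
by apply: class_CD => //; apply: IH => //; exact: class_C_derive.
Qed.

Lemma class_CN k U f : open U -> class_C k U f -> class_C k U (- f).
Proof.
move=> Uo Cf; have -> : - f = cst (-1) * f by apply/funext => x; rewrite !fctE mulN1r.
by apply: class_CM => //; exact: class_C_cst.
Qed.

Lemma class_CB k U f g : open U ->
  class_C k U f -> class_C k U g -> class_C k U (f - g).
Proof. by move=> Uo Cf Cg; apply: class_CD => //; exact: class_CN. Qed.

Lemma class_CZ k U (c : R) f : open U -> class_C k U f -> class_C k U (c *: f).
Proof. by move=> Uo Cf; apply: (class_CM Uo) => //; exact: class_C_cst. Qed.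

(** Smoothness on an open set, in the form in which [smooth_on] provides it. *)
Definition smooth U f := forall k, class_C k U f.

Lemma smoothD U f g : open U -> smooth U f -> smooth U g -> smooth U (f + g).
Proof. by move=> Uo Cf Cg k; exact: class_CD. Qed.

Lemma smoothB U f g : open U -> smooth U f -> smooth U g -> smooth U (f - g).
Proof. by move=> Uo Cf Cg k; exact: class_CB. Qed.

Lemma smoothM U f g : open U -> smooth U f -> smooth U g -> smooth U (f * g).
Proof. by move=> Uo Cf Cg k; exact: class_CM. Qed.

Lemma smooth_cst U (c : R) : smooth U (cst c).
Proof. by move=> k; exact: class_C_cst. Qed.

Lemma smooth_derive U f v : smooth U f -> smooth U ('D_v f).
Proof. by move=> Cf k; have [_ /(_ v)] := Cf k.+1. Qed.

Lemma smooth_differentiable U f x : smooth U f -> U x -> differentiable f x.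
Proof. by move=> Cf Ux; have [df _] := Cf 1; exact: df. Qed.

Lemma smooth_continuous U f x : smooth U f -> U x -> {for x, continuous f}.
Proof. by move=> Cf Ux; exact: (Cf 0 x Ux). Qed.

Lemma smooth_sub U U' f : U' `<=` U -> smooth U f -> smooth U' f.
Proof. by move=> UU' Cf k; exact: class_C_sub UU' (Cf k). Qed.

Lemma smooth_eq U f g : open U -> (forall x, U x -> f x = g x) ->
  smooth U f -> smooth U g.
Proof. by move=> Uo fg Cf k; exact: class_C_eq Uo fg (Cf k). Qed.

End ClassC.

Lemma diff_real {R : realType} (g : R -> R) (x v : R) :
  'd g x v = v * 'd g x 1.
Proof.
rewrite -[LHS]/('d g x v) -[in LHS](mulr1 v) -[v * 1]/(v *: (1 : R)).
by rewrite linearZ.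
Qed.

Section Composition.
Context {R : realType} {V : normedModType R}.
Implicit Types (f : V -> R) (U : set V) (k : nat).

Lemma class_C_comp k U f (D : set R) (g : R -> R) : open U ->
  (forall x, U x -> D (f x)) -> class_C k D g -> class_C k U f ->
  class_C k U (g \o f).
Proof.
move=> Uo UD; elim: k f g UD => [|k IH] f g UD.
  move=> gc fc x Ux; apply: continuous_comp; first exact: fc.
  exact/gc/UD.
move=> Cg Cf.
have df := class_C_differentiable Cf; have dg := class_C_differentiable Cg.
split=> [x Ux|v].
  by apply: differentiable_comp; [exact: df|exact/dg/UD].
apply: (@class_C_eq _ _ _ _ (('D_1 g \o f) * 'D_v f)) => //; last first.
  apply: class_CM => //; last exact: class_C_derive.
  by apply: IH => //; [exact: class_C_derive|exact: class_CS].
move=> x Ux; have dfx := df x Ux; have dgx := dg _ (UD _ Ux).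
have e : 'D_v (g \o f) x = 'd g (f x) ('d f x v).
  have := congr1 (@^~ v) (diff_comp dfx dgx) => /= <-.
  by apply: deriveE; exact: differentiable_comp.
rewrite e diff_real -[LHS]/('D_1 g (f x) * 'D_v f x).
by rewrite (deriveE _ dfx) (deriveE _ dgx) mulrC.
Qed.

Lemma smooth_comp U f (D : set R) (g : R -> R) : open U ->
  (forall x, U x -> D (f x)) -> smooth D g -> smooth U f ->
  smooth U (g \o f).
Proof. by move=> Uo UD Cg Cf k; exact: class_C_comp Uo UD (Cg k) (Cf k). Qed.

End Composition.

Section RealFunctions.
Context {R : realType}.

Lemma derive_scale (f : R -> R) (v x : R) : differentiable f x ->
  'D_v f x = v * 'D_1 f x.
Proof.
move=> dfx; rewrite (deriveE v dfx) (deriveE (1 : R) dfx); exact: diff_real.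
Qed.

Lemma smooth_expR : smooth [set: R] expR.
Proof.
move=> k; elim: k => [|k IH] /=; first by move=> x _; exact: continuous_expR.
have d x : differentiable (@expR R) x by exact/derivable1_diffP/derivable_expR.
split=> [x _|v]; first exact: d.
apply: (class_C_eq (f := v *: expR)) (class_CZ _ _ IH); [exact: openT| |exact: openT].
by move=> x _; rewrite derive_scale // derive_val.
Qed.

(** The derivative of [1/x] is [- v / x^2], a product of the function itself with
    itself, so that closure under products drives the induction on the order. *)
Lemma smooth_inv : smooth [set x : R | x != 0] GRing.inv.
Proof.
have o : open [set x : R | x != 0] by exact: open_neq.
move=> k; elim: k => [|k IH] /=; first by move=> x x0; exact: inv_continuous.
split=> [x x0|v]; first exact: differentiable_Rinv.
apply: (class_C_eq (f := (- v) *: ((GRing.inv : R -> R) * (GRing.inv : R -> R)))) => //.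
  move=> x x0; rewrite (deriveE v (differentiable_Rinv x0)) (diff_Rinv x0).
  by rewrite -[LHS]/(- v * (x^-1 * x^-1)) expr2 invfM scaleNr mulNr mulrC.
by apply: class_CZ => //; exact: class_CM.
Qed.

Lemma smooth_ln : smooth [set x : R | 0 < x] (@ln R).
Proof.
have o : open [set x : R | 0 < x] by exact: open_gt.
have d (x : R) : 0 < x -> differentiable (@ln R) x.
  by move=> x0; apply/derivable1_diffP; have [] := is_derive1_ln x0.
case=> [x x0|k]; first exact/differentiable_continuous/d.
split=> [x x0|v]; first exact: d.
apply: (class_C_eq (f := v *: (GRing.inv : R -> R))) => //; last first.
  apply: class_CZ => //; apply: class_C_sub (smooth_inv k) => x x0.
  by rewrite /= gt_eqF.
move=> x x0; rewrite derive_scale; last exact: d.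
by have [_ ->] := is_derive1_ln x0.
Qed.

Lemma smooth_sqrt : smooth [set x : R | 0 < x] (@Num.sqrt R).
Proof.
have o : open [set x : R | 0 < x] by exact: open_gt.
apply: (@smooth_eq _ _ _ (expR \o (2^-1 *: @ln R))) => //; last first.
  apply: (smooth_comp (D := setT)) => //; first exact: smooth_expR.
  by move=> k; apply: class_CZ => //; exact: smooth_ln.
move=> x /= x0; apply/eqP; rewrite -(eqrXn2 (n := 2)) ?expR_ge0 ?sqrtr_ge0 //.
rewrite sqr_sqrtr ?ltW // -[X in expR X]/(2^-1 * ln x) expr2 -expRD -mulrDl.
have -> : 2^-1 + 2^-1 = 1 :> R by lra.
by rewrite mul1r lnK ?posrE.
Qed.

End RealFunctions.

(** * Functions of a real variable and a parameter *)

Section Param.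
Context {R : realType} {W : normedModType R}.
Implicit Types (f g : R * W -> R) (U D : set (R * W)) (k : nat) (p v : R * W).

Lemma is_diff_fst p : is_diff p (fst : R * W -> R) fst.
Proof.
have c : continuous (fst : R * W -> R) by move=> q; exact: cvg_fst.
by apply: DiffDef; [exact: linear_differentiable|rewrite diff_lin].
Qed.

Lemma is_diff_snd p : is_diff p (snd : R * W -> W) snd.
Proof.
have c : continuous (snd : R * W -> W) by move=> q; exact: cvg_snd.
by apply: DiffDef; [exact: linear_differentiable|rewrite diff_lin].
Qed.

Lemma derive_split f p (a : R) (w : W) : differentiable f p ->
  'D_(a, w) f p = a * 'D_(1, 0) f p + 'D_(0, w) f p.
Proof.
move=> df; rewrite !(deriveE _ df).
have -> : (a, w) = a *: (1, 0) + (0, w) :> R * W.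
  by congr pair; rewrite /= ?scaler0 ?add0r // addr0 [_ *: _]mulr1.
by rewrite linearP.
Qed.

Lemma is_diff_subst f g p : differentiable f p ->
  differentiable g (f p, p.2) ->
  is_diff p (fun q => g (f q, q.2)) (fun v => 'd g (f p, p.2) ('d f p v, v.2)).
Proof.
move=> df dg.
have dpair := is_diff_pair (differentiableP df) (is_diff_snd p).
exact: (is_diff_comp dpair (differentiableP dg)).
Qed.

(** For a substitution [(f p, p.2)], which alters the first variable and carries
    the second along, the chain rule involves the two directions [(1, 0)] and
    [(0, v.2)] only; a general substitution would call for a basis of [W]. *)
Lemma derive_subst f g p v : differentiable f p ->
  differentiable g (f p, p.2) ->
  'D_v (fun q => g (f q, q.2)) p =
  'D_v f p * 'D_(1, 0) g (f p, p.2) + 'D_(0, v.2) g (f p, p.2).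
Proof.
move=> df dg.
rewrite -(derive_split _ _ dg) (deriveE _ dg) (deriveE _ df).
exact: (is_diff_derive v (is_diff_subst df dg)).
Qed.

Lemma class_C_subst k U f D g : open U ->
  (forall p, U p -> D (f p, p.2)) -> class_C k D g -> class_C k U f ->
  class_C k U (fun p => g (f p, p.2)).
Proof.
move=> Uo UD; elim: k f g UD => [|k IH] f g UD.
  move=> gc fc p Up; apply: (continuous_comp (f := fun q => (f q, q.2))).
    apply: (@cvg_pair _ _ _ (nbhs p) (nbhs (f p)) (nbhs p.2)); first exact: fc.
    exact: cvg_snd.
  exact/gc/UD.
move=> Cg Cf.
have df := class_C_differentiable Cf; have dg := class_C_differentiable Cg.
split=> [p Up|v].
  by have [] := is_diff_subst (df p Up) (dg _ (UD p Up)).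
apply: (@class_C_eq _ _ _ _ ('D_v f * (fun p => 'D_(1, 0) g (f p, p.2)) +
    (fun p => 'D_(0, v.2) g (f p, p.2)))) => //.
  by move=> p Up; rewrite (derive_subst v (df p Up) (dg _ (UD p Up))).
have IHg w : class_C k U (fun p => 'D_w g (f p, p.2)).
  by apply: (IH f ('D_w g)) => //; [exact: class_C_derive|exact: class_CS].
by apply: class_CD => //; apply: class_CM => //; exact: class_C_derive.
Qed.

Lemma smooth_subst U f D g : open U ->
  (forall p, U p -> D (f p, p.2)) -> smooth D g -> smooth U f ->
  smooth U (fun p => g (f p, p.2)).
Proof. by move=> Uo UD Dg Uf k; exact: class_C_subst Uo UD (Dg k) (Uf k). Qed.

Lemma smooth_fst U : smooth U fst.
Proof.
case=> [p _|k]; first exact: cvg_fst.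
split=> [p _|v]; first by have := is_diff_fst p.
have -> : 'D_v fst = cst v.1 :> (R * W -> R).
  by apply/funext => p; rewrite (is_diff_derive v (is_diff_fst p)).
exact: class_C_cst.
Qed.

Lemma derive_fst v p : 'D_v fst p = v.1 :> R.
Proof. exact: (is_diff_derive v (is_diff_fst p)). Qed.

Lemma is_derive_line f (x : R) (y : W) : differentiable f (x, y) ->
  is_derive x 1 (fun z => f (z, y)) ('D_(1, 0) f (x, y)).
Proof.
move=> df.
have dl : is_diff x (fun z : R => (z, y)) (fun z : R => (z, 0)).
  exact: (is_diff_pair (is_diff_id x) (is_diff_cst y x)).
have dc := is_diff_comp dl (differentiableP df).
have [dc1 _] := dc.
rewrite (deriveE _ df); apply: DeriveDef; first exact: diff_derivable.
exact: (is_diff_derive (1 : R) dc).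
Qed.

Lemma continuous_line f (x : R) (y : W) : {for (x, y), continuous f} ->
  {for x, continuous (fun z => f (z, y))}.
Proof.
move=> fc; apply: (continuous_comp (f := fun z : R => (z, y))); last exact: fc.
apply: (@cvg_pair _ _ _ (nbhs x) (nbhs x) (nbhs y)); first exact: cvg_id.
exact: cvg_cst.
Qed.

End Param.

(** * Difference quotients *)

Section Slope.
Context {R : realType}.

(** The intermediate point is located by its distance to [x0] rather than in an
    interval, so that the order of [x0] and [x] is irrelevant; and [f] need not be
    derivable at [x0], which matters when [f] is a quotient by [x - x0]. *)
Lemma MVT_ball (f df : R -> R) (x0 x : R) : {for x0, continuous f} ->
  (forall z, z != x0 -> `|z - x0| <= `|x - x0| -> is_derive z 1 f (df z)) ->
  exists2 z, `|z - x0| <= `|x - x0| & f x = f x0 + (x - x0) * df z.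
Proof.
move=> fc fd; have [->|xx0] := eqVneq x x0.
  by exists x0; rewrite // subrr mul0r addr0.
have fcz z : `|z - x0| <= `|x - x0| -> {for z, continuous f}.
  have [-> //|zx0 zx] := eqVneq z x0.
  have [dfz _] := fd z zx0 zx.
  exact/differentiable_continuous/derivable1_diffP.
have [xlt|xlt|/eqP] := ltgtP x x0; last by rewrite (negbTE xx0).
- have inb z : z \in `[x, x0] -> `|z - x0| <= `|x - x0|.
    rewrite in_itv /= => /andP[xz zx].
    by rewrite !ler0_norm ?subr_le0 ?(ltW xlt) // lerN2 lerD2r.
  have [||z zI zE] := MVT (df := df) (f := f) xlt.
  + move=> z zI; apply: fd; last by apply: inb; exact: subset_itv_oo_cc.
    by move: zI; rewrite in_itv /= => /andP[_ /lt_eqF ->].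
  + apply: continuous_in_subspaceT => z; rewrite inE => zI; exact/fcz/inb.
  exists z; first by apply: inb; exact: subset_itv_oo_cc.
  by rewrite -[f x0](subrK (f x)) zE; ring.
- have inb z : z \in `[x0, x] -> `|z - x0| <= `|x - x0|.
    rewrite in_itv /= => /andP[xz zx].
    by rewrite !ger0_norm ?subr_ge0 ?(ltW xlt) // lerD2r.
  have [||z zI zE] := MVT (df := df) (f := f) xlt.
  + move=> z zI; apply: fd; last by apply: inb; exact: subset_itv_oo_cc.
    by move: zI; rewrite in_itv /= => /andP[/gt_eqF ->].
  + apply: continuous_in_subspaceT => z; rewrite inE => zI; exact/fcz/inb.
  exists z; first by apply: inb; exact: subset_itv_oo_cc.
  by rewrite mulrC -zE addrC subrK.
Qed.

Context {W : normedModType R}.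
Implicit Types (F g : R * W -> R) (p q : R * W).

(** The difference quotient of [F] in the first variable at [p.1] equals [g] at an
    intermediate point, hence tends to [g p] jointly in both variables. *)
Lemma exists_slope F g p : {for p, continuous g} ->
  (\forall q \near p, exists2 z, `|z - p.1| <= `|q.1 - p.1| &
     F q = F (p.1, q.2) + (q.1 - p.1) * g (z, q.2)) ->
  exists k : R * W -> R, [/\ {for p, continuous k}, k p = g p &
    \forall q \near p, F q = F (p.1, q.2) + (q.1 - p.1) * k q].
Proof.
move=> gc Fg.
pose k q := if q.1 == p.1 then g (p.1, q.2) else (F q - F (p.1, q.2)) / (q.1 - p.1).
have kp : k p = g p by rewrite /k eqxx -surjective_pairing.
have kE q : q.1 != p.1 -> (q.1 - p.1) * k q = F q - F (p.1, q.2).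
  by move=> qp; rewrite /k (negbTE qp) mulrC divfK // subr_eq0.
exists k; split=> //.
- apply/cvgrPdist_lt => e e0; rewrite kp.
  have /cvgrPdist_lt /(_ e e0) := gc.
  move=> /nbhs_ballP[d /= d0 gd].
  have dp : nbhs p (ball p d) by exact: nbhsx_ballx.
  near=> q.
  have [dq1 dq2] : ball p d q by near: q; exact: dp.
  have kz z : `|z - p.1| <= `|q.1 - p.1| -> `|g p - g (z, q.2)| < e.
    move=> zq; apply: gd; split=> //=.
    apply: le_lt_trans dq1; by rewrite distrC [leRHS]distrC.
  have [qp|qp] := eqVneq q.1 p.1.
    by rewrite /k qp eqxx; apply: kz; rewrite subrr normr0.
  have [z zq Fz] : exists2 z, `|z - p.1| <= `|q.1 - p.1| &
     F q = F (p.1, q.2) + (q.1 - p.1) * g (z, q.2) by near: q.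
  suff -> : k q = g (z, q.2) by exact: kz.
  have qp0 : q.1 - p.1 != 0 by rewrite subr_eq0.
  by apply: (mulfI qp0); rewrite kE // Fz addrAC subrr add0r.
- near=> q; have [qp|qp] := eqVneq q.1 p.1.
    by rewrite qp subrr mul0r addr0 -qp -surjective_pairing.
  by rewrite kE // addrC subrK.
Unshelve. all: by end_near. Qed.

End Slope.

(** * Inverse functions with a parameter *)

Section InverseFunction.
Context {R : realType} {W : normedModType R}.
Implicit Types (F : R * W -> R) (U : set (R * W)) (p q : R * W).

Lemma exists_slope_smooth U F p : open U -> U p -> smooth U F ->
  exists k : R * W -> R, [/\ {for p, continuous k}, k p = 'D_(1, 0) F p &
    \forall q \near p, F q = F (p.1, q.2) + (q.1 - p.1) * k q].
Proof.
move=> Uo Up CF; apply: (exists_slope (g := 'D_(1, 0) F)).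
  by apply: smooth_continuous Up; exact: smooth_derive.
have /nbhs_ballP[d /= d0 dU] : nbhs p U by exact: open_nbhs_nbhs.
have dp : nbhs p (ball p d) by exact: nbhsx_ballx.
near=> q; have [dq1 dq2] : ball p d q by near: q; exact: dp.
have Uz z : `|z - p.1| <= `|q.1 - p.1| -> U (z, q.2).
  move=> zq; apply: dU; split=> //=.
  by apply: le_lt_trans dq1; rewrite distrC [leRHS]distrC.
have dz z : `|z - p.1| <= `|q.1 - p.1| ->
    is_derive z 1 (fun z => F (z, q.2)) ('D_(1, 0) F (z, q.2)).
  by move=> /Uz Uzq; exact: is_derive_line (smooth_differentiable CF Uzq).
have Fc : {for p.1, continuous (fun z => F (z, q.2))}.
  have [|d1 _] := dz p.1; first by rewrite subrr normr0.
  exact/differentiable_continuous/derivable1_diffP.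
have [z zq Fz] := MVT_ball (x := q.1) Fc (fun z _ zq => dz z zq).
by exists z; rewrite // [in LHS](surjective_pairing q).
Unshelve. all: by end_near. Qed.

Section Inverse.
Variables (F : R * W -> R) (U : set (R * W)) (N : set (R * W)).
Variables (G : R * W -> R).
Hypotheses (Uo : open U) (CF : smooth U F) (No : open N).
Hypothesis F'0 : forall p, U p -> 0 < 'D_(1, 0) F p.
Hypothesis GU : forall p, N p -> U (G p, p.2).
Hypothesis GK : forall p, N p -> F (G p, p.2) = p.1.
Hypothesis Gc : forall p, N p -> {for p, continuous G}.

(* Implicit differentiation of F (G p, p.2) = p.1. *)
Let dG p (v : R * W) :=
  (v.1 - 'D_(0, v.2) F (G p, p.2)) * ('D_(1, 0) F (G p, p.2))^-1.

(** With [k] the slope of [F] in its first variable at [(G p, p.2)], one has near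
    [p] the identity
    [G p' = G p + (p'.1 - F (G p, p'.2)) / k (G p', p'.2)];
    the numerator is differentiable and vanishes at [p], and the denominator is
    continuous and nonzero because [G] is continuous. *)
Lemma inverse_is_diff p : N p ->
  differentiable G p /\ forall v, 'D_v G p = dG p v.
Proof.
move=> Np; set q := (G p, p.2).
have Uq : U q by exact: GU.
have [k [kc kq kF]] := exists_slope_smooth Uo Uq CF.
have Gqc : {for p, continuous (fun p => (G p, p.2))}.
  apply: (@cvg_pair _ _ _ (nbhs p) (nbhs (G p)) (nbhs p.2)); first exact: Gc.
  exact: cvg_snd.
have k0 : 0 < k q by rewrite kq F'0.
have kqc : {for p, continuous (fun p => (k (G p, p.2))^-1)}.
  apply: continuousV; first by rewrite gt_eqF.
  by apply: (continuous_comp (f := fun p => (G p, p.2))).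
have dF := smooth_differentiable CF Uq.
have dcst := differentiable_cst (G p) p.
have dl := is_diffB (is_diff_fst p) (is_diff_subst (f := cst (G p)) dcst dF).
have := is_diff_vanishing_mul dl _ kqc.
have l0 : (fst - (fun q => F (cst (G p) q, q.2))) p = 0.
  by rewrite !fctE /= GK // subrr.
move=> /(_ l0) dlk.
have GE : {near p, cst (G p) + (fst - (fun q => F (cst (G p) q, q.2))) *
    (fun p => (k (G p, p.2))^-1) =1 G}.
  have kn0 : \forall p' \near p, 0 < k (G p', p'.2).
    have kGc : {for p, continuous (fun p => k (G p, p.2))}.
      by apply: (continuous_comp (f := fun p => (G p, p.2))).
    have /cvgrPdist_lt /(_ _ k0) := kGc.
    apply: filterS => p' /=; rewrite -/q.
    by move=> /(le_lt_trans (ler_norm _)); rewrite ltrBlDr ltrDl.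
  have kF' : \forall p' \near p, F (G p', p'.2) = F (G p, p'.2) +
      (G p' - G p) * k (G p', p'.2) by exact: Gqc kF.
  near=> p'.
  have Np' : N p' by near: p'; exact: open_nbhs_nbhs.
  have kp' : k (G p', p'.2) != 0 by rewrite gt_eqF //; near: p'.
  have : F (G p', p'.2) = F (G p, p'.2) + (G p' - G p) * k (G p', p'.2) by near: p'.
  rewrite GK // => e.
  rewrite -[LHS]/(G p + (p'.1 - F (G p, p'.2)) * (k (G p', p'.2))^-1).
  by rewrite {1}e addrAC subrr add0r mulfK // addrC subrK.
have := near_is_diff GE (is_diffD (is_diff_cst _ _) dlk).
move=> dGp; split=> [|v]; first by have [] := dGp.
have e : 'd (cst (G p)) p v = 0 :> R by exact: (congr1 (@^~ v) (diff_cst (G p) p)).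
apply: (eq_trans (is_diff_derive v dGp)).
have dFq : 'D_(0, v.2) F q = 'd F q (0, v.2) by exact: deriveE.
suff E a : a = 0 -> 0 + (k q)^-1 * (v.1 - 'd F q (a, v.2)) = dG p v by exact: E.
move=> ->; rewrite /dG -[(G p, p.2)]/q -kq dFq add0r; exact: mulrC.
Unshelve. all: by end_near. Qed.

(** The derivative of [G] is an expression in [G] and derivatives of [F], so [G] is
    of class [C^(k+1)] as soon as it is of class [C^k]. *)
Lemma inverse_smooth : smooth N G.
Proof.
elim=> [|k IH]; first exact: Gc.
split=> [p Np|v]; first by have [] := inverse_is_diff Np.
have CFG w : class_C k N (fun p => 'D_w F (G p, p.2)).
  apply: (class_C_subst (g := 'D_w F) No GU _ IH).
  by have := smooth_derive w CF; exact.
apply: (@class_C_eq _ _ _ _ ((cst v.1 - (fun p => 'D_(0, v.2) F (G p, p.2))) *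
   (GRing.inv \o (fun p => 'D_(1, 0) F (G p, p.2))))) => //.
  by move=> p Np; have [_ ->] := inverse_is_diff Np.
apply: class_CM => //.
  by apply: class_CB => //; exact: class_C_cst.
apply: (class_C_comp No _ (smooth_inv k)).
  by move=> p Np /=; rewrite gt_eqF // F'0 //; exact: GU.
by [].
Qed.

End Inverse.

End InverseFunction.

Section ImplicitFunction.
Context {R : realType} {W : normedModType R}.
Implicit Types (F G : R * W -> R) (U N : set (R * W)) (p q : R * W).

(** Inverse function theorem for a real variable with the parameter [y]. Near
    [(x0, y0)] the function [F] increases in [x] with slope at least a constant
    [c > 0]. This gives existence by the intermediate value theorem, uniqueness
    and, as [c] is the same for all [y], joint continuity of the inverse. *)
Theorem smooth_local_inverse F U (x0 : R) (y0 : W) :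
  open U -> U (x0, y0) -> smooth U F -> 0 < 'D_(1, 0) F (x0, y0) ->
  exists (d : R) N G, [/\ 0 < d, open_nbhs (F (x0, y0), y0) N, smooth N G,
    forall p, N p -> U (G p, p.2) &
    forall x y, `|x - x0| <= d -> N (F (x, y), y) -> G (F (x, y), y) = x].
Proof.
move=> Uo Up0 CF F'0.
pose c := 'D_(1, 0) F (x0, y0) / 2.
have c0 : 0 < c by rewrite divr_gt0.
have [d [d0 dU dc]] : exists d : R, [/\ 0 < d, ball (x0, y0) d `<=` U &
    forall p, ball (x0, y0) d p -> c < 'D_(1, 0) F p].
  have F'c : {for (x0, y0), continuous ('D_(1, 0) F)}.
    by apply: smooth_continuous Up0; exact: smooth_derive.
  have : \forall p \near (x0, y0), U p /\ c < 'D_(1, 0) F p.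
    near=> p; split; first by near: p; exact: open_nbhs_nbhs.
    near: p; apply: cvgr_gt F'c _ _.
    by rewrite ltr_pdivrMr // ltr_pMr // ltr1n.
  move=> /nbhs_ballP[d /= d0 H]; exists d; split=> // p /H [] //.
pose B := ball (x0, y0) d.
have Bo : open B by exact: ball_open.
have CFB : smooth B F by exact: smooth_sub CF.
have dF x y : `|x - x0| < d -> ball y0 d y -> differentiable F (x, y).
  move=> xd yd; apply: (smooth_differentiable CFB); split=> //=.
  by rewrite /ball /= distrC.
have Bxy x y : `|x - x0| < d -> ball y0 d y -> B (x, y).
  by move=> xd yd; split=> //=; rewrite /ball /= distrC.
(* Intermediate points of two points within e of x0 lie within 3 e < d of x0. *)
pose e := d / 4.
have e0 : 0 < e by rewrite divr_gt0.
have slope z x y : `|z - x0| <= e -> `|x - x0| <= e -> ball y0 d y ->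
    exists2 s, c < s & F (x, y) = F (z, y) + (x - z) * s.
  move=> ze xe yd.
  have dz w : `|w - z| <= `|x - z| ->
      is_derive w 1 (fun w => F (w, y)) ('D_(1, 0) F (w, y)) /\ `|w - x0| < d.
    move=> wz.
    have wd : `|w - x0| < d.
      have := ler_distD z w x0; have := ler_distD x0 x z.
      rewrite [`|x0 - z|]distrC /e in ze xe *; lra.
    by split=> //; apply: is_derive_line; exact: dF.
  have Fc : {for z, continuous (fun w => F (w, y))}.
    have [|[d1 _] _] := dz z; first by rewrite subrr normr0.
    exact/differentiable_continuous/derivable1_diffP.
  have [w wz ->] := MVT_ball (x := x) Fc (fun w _ wz => (dz w wz).1).
  by exists ('D_(1, 0) F (w, y)) => //; apply: dc; apply: Bxy => //; have [] := dz w wz.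
have [e1 e10 e1F] : exists2 e1 : R, 0 < e1 & forall y, ball y0 e1 y ->
    `|F (x0, y) - F (x0, y0)| < c * e / 2.
  have Fc : {for y0, continuous (fun y => F (x0, y))}.
    apply: (continuous_comp (f := fun y => (x0, y))).
      apply: (@cvg_pair _ _ _ (nbhs y0) (nbhs x0) (nbhs y0)); first exact: cvg_cst.
      exact: cvg_id.
    exact: smooth_continuous CF Up0.
  have /cvgrPdist_lt /(_ (c * e / 2)) := Fc; rewrite divr_gt0 ?mulr_gt0 // => /(_ isT).
  by move=> /nbhs_ballP[e1 /= e10 H]; exists e1 => // y /H; rewrite distrC.
pose e2 := Num.min (c * e / 2) (Num.min e1 d).
have e20 : 0 < e2 by rewrite !lt_min e10 d0 divr_gt0 ?mulr_gt0.
pose N := ball (F (x0, y0), y0) e2.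
have Nd p : N p -> ball y0 d p.2.
  by move=> [_]; apply: le_ball; rewrite !ge_min lexx !orbT.
(* From x0 to x0 - e or x0 + e the value of F changes by more than c e, while p.1
   and F (x0, p.2) are both within c e / 2 of F (x0, y0). *)
have ex p : N p -> exists x, `|x - x0| <= e /\ F (x, p.2) = p.1.
  move=> Np; have yd := Nd p Np; have [p1 p2] := Np.
  have {}p1 : `|p.1 - F (x0, y0)| < c * e / 2.
    rewrite distrC; apply: lt_le_trans p1 _; by rewrite ge_min lexx.
  have {p2} : `|F (x0, p.2) - F (x0, y0)| < c * e / 2.
    by apply: e1F; apply: le_ball p2; rewrite !ge_min lexx !orbT.
  move=> p2.
  have x0e : `|x0 - x0| <= e by rewrite subrr normr0 ltW.
  have l1 : `|x0 + e - x0| <= e by rewrite addrAC subrr add0r gtr0_norm.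
  have l2 : `|x0 - e - x0| <= e by rewrite addrAC subrr add0r normrN gtr0_norm.
  have [s1 cs1 F1] := slope _ _ _ x0e l1 yd.
  have [s2 cs2 F2] := slope _ _ _ x0e l2 yd.
  have [|||x xI Fx] := @IVT _ (fun x => F (x, p.2)) (x0 - e) (x0 + e) p.1.
  - by rewrite lerD2l; have := e0; lra.
  - apply: derivable_within_continuous => z; rewrite in_itv /= => zI.
    have [|//] := @is_derive_line _ _ F z p.2.
    apply: dF => //; rewrite ltr_norml; rewrite /e in zI; lra.
  - have e1' : F (x0 - e, p.2) <= p.1.
      move: p1 p2; rewrite !ltr_norml F2 => /andP[? ?] /andP[? ?]; nra.
    have e2' : p.1 <= F (x0 + e, p.2).
      move: p1 p2; rewrite !ltr_norml F1 => /andP[? ?] /andP[? ?]; nra.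
    by rewrite ge_min e1' le_max e2' orbT.
  - exists x; split=> //; move: xI; rewrite in_itv /= ler_norml; lra.
pose G p := xget x0 [set x | `|x - x0| <= e /\ F (x, p.2) = p.1].
have GP p : N p -> `|G p - x0| <= e /\ F (G p, p.2) = p.1.
  by move=> /ex; exact: xgetPex.
have GB p : N p -> B (G p, p.2).
  move=> Np; have [h _] := GP p Np; apply: Bxy; last exact: Nd.
  by apply: le_lt_trans h _; rewrite /e; lra.
have No : open N by exact: ball_open.
exists e, N, G; split=> //.
- by split=> //; exact: ballxx.
- apply: (@inverse_smooth _ _ F B) => //.
  + by move=> p /dc; exact: lt_trans.
  + by move=> p /GP[].
  + move=> p Np; apply/cvgrPdist_lt => r r0.
    have [Gp FGp] := GP p Np.
    have Fc : {for p, continuous (fun q => q.1 - F (G p, q.2))}.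
      apply: continuousB; first exact: cvg_fst.
      apply: (continuous_comp (f := fun q => (G p, q.2))).
        apply: (@cvg_pair _ _ _ (nbhs p) (nbhs (G p)) (nbhs p.2)); first exact: cvg_cst.
        exact: cvg_snd.
      exact: smooth_continuous CFB (GB p Np).
    have /cvgrPdist_lt /(_ (c * r)) := Fc; rewrite mulr_gt0 // => /(_ isT) H.
    have nN : nbhs p N by exact: open_nbhs_nbhs.
    near=> q.
    have Nq : N q by near: q; exact: nN.
    have [Gq FGq] := GP q Nq.
    have : `|p.1 - F (G p, p.2) - (q.1 - F (G p, q.2))| < c * r by near: q.
    have [s cs Fs] := slope _ _ _ Gp Gq (Nd q Nq).
    rewrite FGp subrr sub0r normrN -FGq Fs addrAC subrr add0r normrM.
    rewrite distrC (gtr0_norm (lt_trans c0 cs)) => h.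
    rewrite -(ltr_pM2l c0); apply: le_lt_trans h; rewrite mulrC.
    by rewrite ler_wpM2l // ltW.
- by move=> p /GB /dU.
- move=> x y xe Np; have [Gx FGx] := GP _ Np.
  have [s cs] := slope _ _ _ xe Gx (Nd _ Np).
  rewrite FGx /= => /eqP; rewrite addrC -subr_eq subrr eq_sym mulf_eq0.
  by rewrite (gt_eqF (lt_trans c0 cs)) orbF subr_eq0 => /eqP.
Unshelve. all: by end_near. Qed.

End ImplicitFunction.

(** * Symmetry of second derivatives *)

Section SymmetryOfDerivatives.
Context {R : realType} {V : normedModType R}.
Implicit Types (f : V -> R) (U : set V) (x v w : V).

Lemma is_derive_ray f x v (s : R) : differentiable f (x + s *: v) ->
  is_derive s 1 (fun s => f (x + s *: v)) ('D_v f (x + s *: v)).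
Proof.
move=> df.
have dl : is_diff s (fun s : R => x + s *: v) (fun s : R => s *: v).
  have -> : (fun s : R => s *: v) = (0 : R -> V) + ( *:%R^~ v).
    by apply/funext => z; rewrite !fctE add0r.
  exact: (is_diffD (is_diff_cst x s) (is_diff_scalel s v)).
have dc := is_diff_comp dl (differentiableP df).
have [dc1 _] := dc; apply: DeriveDef; first exact: diff_derivable.
apply: (eq_trans (is_diff_derive (1 : R) dc)) => /=.
by rewrite scale1r (deriveE _ df).
Qed.

(** The second difference along [v] and [w], divided by [s^2], is a value of the
    mixed derivative taken in either order; comparing the two as [s] tends to [0]
    yields [deriveC]. *)
Lemma second_difference f U x v w (d s : R) :
  ball x d `<=` U -> smooth U f -> 0 < s -> s * (`|v| + `|w|) < d ->
  exists2 p, ball x d p &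
    f (x + s *: v + s *: w) - f (x + s *: v) - f (x + s *: w) + f x =
    s * s * 'D_w ('D_v f) p.
Proof.
move=> dU Cf s0 sd.
have Bx (a b : R) : `|a| <= s -> `|b| <= s -> ball x d (x + b *: w + a *: v).
  move=> sa sb; rewrite -ball_normE /= -addrA opprD addrA subrr sub0r normrN.
  apply: le_lt_trans sd; apply: le_trans (ler_normD _ _) _.
  rewrite addrC mulrDr !normrZ lerD // ler_wpM2r //.
have dg g : smooth U g -> forall y, ball x d y -> differentiable g y.
  by move=> Cg y /dU; exact: smooth_differentiable.
have s00 : `|0 : R| <= s by rewrite normr0 ltW.
have ss : `|s| <= s by rewrite gtr0_norm.
pose phi a := f (x + s *: w + a *: v) - f (x + 0 *: w + a *: v).
pose dphi a := 'D_v f (x + s *: w + a *: v) - 'D_v f (x + 0 *: w + a *: v).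
have Dphi (a : R) : `|a - 0| <= `|s - 0| -> is_derive a 1 phi (dphi a).
  rewrite !subr0 (gtr0_norm s0) => sa.
  by apply: is_deriveB; apply: is_derive_ray; apply: (dg f Cf); exact: Bx.
have phic : {for (0 : R), continuous phi}.
  have [|d1 _] := Dphi 0; first by rewrite subrr normr0.
  exact/differentiable_continuous/derivable1_diffP.
have [a] := MVT_ball phic (fun a _ => Dphi a).
rewrite !subr0 (gtr0_norm s0) => sa phiE.
pose psi b := 'D_v f (x + a *: v + b *: w).
have Cvf : smooth U ('D_v f) by exact: smooth_derive.
have Dpsi (b : R) : `|b - 0| <= `|s - 0| ->
    is_derive b 1 psi ('D_w ('D_v f) (x + a *: v + b *: w)).
  rewrite !subr0 (gtr0_norm s0) => sb.
  by apply: is_derive_ray; apply: (dg _ Cvf); rewrite addrAC; exact: Bx.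
have psic : {for (0 : R), continuous psi}.
  have [|d1 _] := Dpsi 0; first by rewrite subrr normr0.
  exact/differentiable_continuous/derivable1_diffP.
have [b] := MVT_ball psic (fun b _ => Dpsi b).
rewrite !subr0 (gtr0_norm s0) => sb psiE.
exists (x + a *: v + b *: w); first by rewrite addrAC; exact: Bx.
rewrite -mulrA -[s * 'D_w _ _](addKr (psi 0)) -psiE.
have -> : - psi 0 + psi s = dphi a.
  by rewrite addrC /psi /dphi !scale0r !addr0 addrAC.
rewrite -[s * dphi a](addKr (phi 0)) -phiE addrC /phi !scale0r !addr0.
by rewrite [x + s *: w + _]addrAC; ring.
Qed.

Lemma eq_of_near_values (A B : V -> R) x :
  {for x, continuous A} -> {for x, continuous B} ->
  (forall d : R, 0 < d -> exists p q, [/\ ball x d p, ball x d q & A p = B q]) ->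
  A x = B x.
Proof.
move=> Ac Bc AB; apply/eqP; rewrite -subr_eq0 -normr_le0.
apply/ler_addgt0Pr => e e0; rewrite add0r.
have e20 : 0 < e / 2 by rewrite divr_gt0.
have /cvgrPdist_lt /(_ _ e20) HA := Ac.
have /cvgrPdist_lt /(_ _ e20) HB := Bc.
have : \forall t \near x, `|A x - A t| < e / 2 /\ `|B x - B t| < e / 2.
  by apply: filterS2 HA HB => t.
move=> /nbhs_ballP[d /= d0 H].
have [p [q [/H[Ap _] /H[_ Bq] ABpq]]] := AB d d0.
have := ler_distD (B q) (A x) (B x).
rewrite -{1}ABpq [`|B q - B x|]distrC; lra.
Qed.

Lemma deriveC f U x v w : open U -> U x -> smooth U f ->
  'D_v ('D_w f) x = 'D_w ('D_v f) x.
Proof.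
move=> Uo Ux Cf.
have C2 v' w' : {for x, continuous ('D_v' ('D_w' f))}.
  by apply: smooth_continuous Ux; do 2! apply: smooth_derive.
apply: (eq_of_near_values (C2 v w) (C2 w v)) => d d0.
have /nbhs_ballP[d' /= d'0 dU'] : nbhs x U by exact: open_nbhs_nbhs.
pose e := Num.min d d'.
have e0 : 0 < e by rewrite lt_min d0.
have eU : ball x e `<=` U.
  by apply: subset_trans dU'; apply: le_ball; rewrite ge_min lexx orbT.
have ed : ball x e `<=` ball x d by apply: le_ball; rewrite ge_min lexx.
have [s s0 sd] : exists2 s : R, 0 < s & s * (`|v| + `|w|) < e.
  exists (e / (1 + (`|v| + `|w|))).
    by rewrite divr_gt0 // ltr_pwDl // addr_ge0.
  rewrite mulrAC ltr_pdivrMr ?ltr_pwDl ?addr_ge0 //.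
  by rewrite ltr_pM2l // ltrDr.
have [p pe pE] := second_difference eU Cf s0 sd.
rewrite addrC in sd.
have [q qe qE] := second_difference eU Cf s0 sd.
have s2 : s * s != 0 by rewrite mulf_neq0 ?gt_eqF.
exists q, p; split; [exact: ed|exact: ed|].
have E : f (x + s *: w + s *: v) - f (x + s *: w) - f (x + s *: v) + f x =
    f (x + s *: v + s *: w) - f (x + s *: v) - f (x + s *: w) + f x.
  by rewrite [x + s *: w + _]addrAC; ring.
exact: mulfI s2 _ _ (etrans (esym qE) (etrans E pE)).
Qed.
End SymmetryOfDerivatives.

(** * Hadamard's lemma *)

Section Hadamard.
Context {R : realType} {W : normedModType R}.
Implicit Types (F : R * W -> R) (p v : R * W) (n k : nat).

Local Notation "\d F" := ('D_(1, 0) F) (at level 10, F at next level).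

Lemma is_derive_invX n (x : R) : x != 0 ->
  is_derive x 1 (fun z : R => (z ^+ n)^-1) (- n%:R * (x ^+ n.+1)^-1).
Proof.
case: n => [|n] x0.
  rewrite oppr0 mul0r; have -> : (fun z : R => (z ^+ 0)^-1) = cst 1.
    by apply/funext => z; rewrite expr0 invr1.
  exact: is_derive_cst.
have xn0 : x ^+ n.+1 != 0 by rewrite expf_neq0.
have dX := @exprn_derivable R n.+1 x 1.
apply: DeriveDef; first exact: (derivableV (f := fun z : R => z ^+ n.+1) xn0 dX).
rewrite (deriveV (f := fun z : R => z ^+ n.+1) xn0 dX) exp_derive.
rewrite [_ *: 1]mulr1.
rewrite -[LHS]/(- (x ^+ n.+1) ^- 2 * (n.+1%:R * x ^+ n)) mulNr mulNr; congr (- _).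
rewrite mulrCA; congr (_ * _).
by rewrite ![x ^+ _.+1]exprS; field; rewrite x0 expf_neq0.
Qed.

(** The function [F / x^n], completed on the axis [x = 0] by the Taylor coefficient
    that is its limit when [F] vanishes to order [n] there. *)
Definition quotX n F p : R :=
  if p.1 == 0 then iter n (fun F => \d F) F (0, p.2) / n`!%:R else F p / p.1 ^+ n.

Variable U : set (R * W).
Hypothesis Uo : open U.
(* U is balanced in the first variable: points given by the mean value theorem
   applied between the axis and a point of U belong to U. *)
Hypothesis Ustar : forall x z y, U (x, y) -> `|z| <= `|x| -> U (z, y).

Fixpoint vanishing n F : Prop :=
  match n with
  | 0 => True
  | n'.+1 => (forall p, U p -> F (0, p.2) = 0) /\ vanishing n' (\d F)
  end.

(** Numerator of the derivative of [F / x^n] with respect to [x]: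
    [(F / x^n)' = (x F' - n F) / x^(n+1)]. *)
Definition euler_numerator n F : R * W -> R := fst * \d F - n%:R *: F.

Let U0 p : U p -> U (0, p.2).
Proof. by case: p => x y /= Up; apply: Ustar Up _; rewrite normr0. Qed.

Lemma smooth_iter n F : smooth U F -> smooth U (iter n (fun F => \d F) F).
Proof. by elim: n => [//|n IH] /IH CF; exact: smooth_derive. Qed.

Lemma smooth_euler n F : smooth U F -> smooth U (euler_numerator n F).
Proof.
move=> CF; apply: smoothB => //.
  by apply: smoothM => //; [exact: smooth_fst|exact: smooth_derive].
by apply: smoothM => //; exact: (@smooth_cst _ _ _ n%:R).
Qed.

Lemma eq_derive_on F F' p v : (forall p, U p -> F p = F' p) -> U p ->
  'D_v F p = 'D_v F' p.
Proof.
move=> FF' Up; apply: near_eq_derive.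
by apply: (filterS (P := U)) => [q /FF' //|]; exact: open_nbhs_nbhs.
Qed.

Lemma eq_vanishing n F F' : (forall p, U p -> F p = F' p) ->
  vanishing n F -> vanishing n F'.
Proof.
elim: n F F' => [//|n IH] F F' FF' [F0 vF]; split=> [p Up|].
  by rewrite -FF' ?F0 //; exact: U0.
by apply: IH vF => p; exact: eq_derive_on.
Qed.

(** Derivatives in the parameter commute with those in the first variable, so they
    preserve the order of vanishing along the axis. *)
Lemma vanishing_derive n F (w : W) : smooth U F ->
  vanishing n F -> vanishing n ('D_(0, w) F).
Proof.
elim: n F => [//|n IH] F CF [F0 vF]; split=> [p Up|].
  have dF := smooth_differentiable CF (U0 Up).
  have e := derive_subst (f := cst 0) (0, w) (differentiable_cst _ _) dF.
  rewrite derive_cst mul0r add0r /= in e; rewrite -e.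
  by rewrite (@eq_derive_on _ (cst 0) p (0, w) F0 Up) derive_cst.
apply: (@eq_vanishing _ ('D_(0, w) (\d F))).
  by move=> p Up; exact: (deriveC _ _ Uo Up CF).
by apply: IH => //; exact: smooth_derive.
Qed.

Lemma derive_euler n F p : smooth U F -> U p ->
  \d (euler_numerator n.+1 F) p = euler_numerator n (\d F) p.
Proof.
move=> CF Up.
have dF := smooth_differentiable CF Up.
have CdF : smooth U (\d F) by exact: smooth_derive.
have ddF := smooth_differentiable CdF Up.
have dfst : differentiable (fst : R * W -> R) p by have [] := is_diff_fst p.
rewrite /euler_numerator deriveB; first last.
- exact/diff_derivable/differentiableZ.
- exact/diff_derivable/differentiableM.
rewrite deriveM ?deriveZ ?derive_fst; try exact: diff_derivable.
rewrite -[LHS]/(p.1 * \d (\d F) p + \d F p * 1 - n.+1%:R * \d F p).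
rewrite -[RHS]/(p.1 * \d (\d F) p - n%:R * \d F p).
by rewrite -[n.+1]addn1 natrD; ring.
Qed.

(** The operator [x d/dx - n] kills the monomial [x^n], so it raises the order of
    vanishing from [n] to [n + 1]. *)
Lemma vanishing_euler n F : smooth U F ->
  vanishing n F -> vanishing n.+1 (euler_numerator n F).
Proof.
elim: n F => [|n IH] F CF vF.
  split=> // p Up; rewrite /euler_numerator -[LHS]/(0 * \d F (0, p.2) - 0 * F (0, p.2)).
  by rewrite !mul0r subr0.
have [F0 vF'] := vF; split.
  move=> p Up; rewrite /euler_numerator.
  rewrite -[LHS]/(0 * \d F (0, p.2) - n.+1%:R * F (0, p.2)).
  by rewrite F0 // mul0r mulr0 subr0.
apply: (@eq_vanishing _ (euler_numerator n (\d F))).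
  by move=> p Up; rewrite derive_euler.
by apply: IH => //; exact: smooth_derive.
Qed.

(** Taylor estimate with a deliberately crude constant: integrating the bound on
    the [n]-th derivative [n] times could only improve [e]. *)
Lemma vanishing_bound n F (c e r : R) (y : W) : smooth U F -> vanishing n F ->
  U (r, y) -> (forall z, `|z| <= `|r| ->
    `|iter n (fun F => \d F) F (z, y) - n`!%:R * c| <= e) ->
  forall x, `|x| <= `|r| -> `|F (x, y) - c * x ^+ n| <= e * `|x| ^+ n.
Proof.
move=> + + Ur; elim: n F c => [|n IH] F c CF vF Hc x xr.
  by rewrite !expr0 !mulr1 -[X in _ - X]mul1r; exact: Hc.
have [F0 vF'] := vF.
have CdF : smooth U (\d F) by exact: smooth_derive.
have {}IH : forall x, `|x| <= `|r| ->
    `|\d F (x, y) - n.+1%:R * c * x ^+ n| <= e * `|x| ^+ n.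
  apply: (IH (\d F)) => // z zr; have := Hc z zr.
  by rewrite iterSr factS natrM mulrA [_ * n.+1%:R]mulrC.
have df (z : R) : `|z| <= `|x| -> is_derive z 1 (fun z => F (z, y) - c * z ^+ n.+1)
    (\d F (z, y) - n.+1%:R * c * z ^+ n).
  move=> zx; have Uz : U (z, y) by apply: Ustar Ur _; exact: le_trans xr.
  apply: is_deriveB.
    exact: is_derive_line (smooth_differentiable CF Uz).
  have dX := @exprn_derivable R n.+1 z 1.
  apply: DeriveDef; first exact: derivableZ.
  rewrite (deriveZ c dX) exp_derive -[LHS]/(c * (n.+1%:R * z ^+ n * 1)).
  by rewrite mulr1 mulrCA mulrA.
have [|df0 _] := df 0; first by rewrite normr0.
have fc : {for (0 : R), continuous (fun z => F (z, y) - c * z ^+ n.+1)}.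
  exact/differentiable_continuous/derivable1_diffP.
have [|z zx ->] := MVT_ball (x := x) fc
    (df := fun z => \d F (z, y) - n.+1%:R * c * z ^+ n).
  by move=> z _; rewrite !subr0; exact: df.
rewrite !subr0 in zx *.
have -> : F (0, y) = 0 by exact: (F0 _ Ur).
rewrite expr0n mulr0 subr0 add0r normrM exprS mulrCA ler_wpM2l //.
apply: (le_trans (IH z (le_trans zx xr))).
have e0 : 0 <= e by apply: le_trans (Hc 0 _); rewrite ?normr0.
by rewrite ler_wpM2l // lerXn2r // nnegrE.
Qed.

Lemma quotX_continuous_on_axis n F (y : W) : smooth U F -> vanishing n F ->
  U (0, y) -> {for (0, y), continuous (quotX n F)}.
Proof.
move=> CF vF Uy; apply/cvgrPdist_le => e e0.
pose D := iter n (fun F => \d F) F.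
have Dc : {for (0, y), continuous D}.
  by apply: smooth_continuous Uy; exact: smooth_iter.
have n0 : 0 < n`!%:R :> R by rewrite ltr0n fact_gt0.
have n1 : 1 <= n`!%:R :> R by rewrite ler1n fact_gt0.
have /cvgrPdist_le /(_ e e0) HD := Dc.
have nU : nbhs (0 : R, y) U by exact: open_nbhs_nbhs.
have : \forall p \near (0 : R, y), U p /\ `|D (0, y) - D p| <= e.
  by apply: filterS2 nU HD => p.
move=> /nbhs_ballP[d /= d0 H].
have dp : nbhs (0 : R, y) (ball (0 : R, y) d) by exact: nbhsx_ballx.
apply: filterS dp => -[x y'] [/= xd yd].
have Hz z : `|z| <= `|x| -> U (z, y') /\ `|D (0, y) - D (z, y')| <= e.
  move=> zx; apply: H; split=> //=.
  move: xd; rewrite /ball /= !sub0r !normrN; exact: le_lt_trans.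
have Ux : U (x, y') by have [] := Hz x (lexx _).
rewrite {1}/quotX eqxx /= -/D.
have [x0|x0] := eqVneq x 0.
  rewrite /quotX /= x0 eqxx -/D -mulrBl normrM normfV (gtr0_norm n0).
  rewrite ler_pdivrMr //; have [|_ h] := Hz 0; first by rewrite normr0.
  by apply: le_trans h _; rewrite ler_peMr // ltW.
rewrite /quotX /= (negbTE x0).
have xn0 : 0 < `|x| ^+ n by rewrite exprn_gt0 // normr_gt0.
rewrite -(ler_pM2r xn0) -normrX -normrM mulrBl divfK ?expf_neq0 // distrC normrX.
apply: (vanishing_bound (r := x)) => // z zx; rewrite -/D mulrC divfK ?gt_eqF //.
by rewrite distrC; have [] := Hz z zx.
Qed.

Lemma iter_derive n F (w : W) : smooth U F -> forall p, U p ->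
  iter n (fun F => \d F) ('D_(0, w) F) p = 'D_(0, w) (iter n (fun F => \d F) F) p.
Proof.
move=> CF; elim: n => [//|n IH] p Up /=.
have CI : smooth U (iter n (fun F => \d F) F) by exact: smooth_iter.
rewrite (deriveC _ _ Uo Up CI).
exact: (@eq_derive_on _ ('D_(0, w) (iter n (fun F => \d F) F)) p (1, 0) IH Up).
Qed.

Lemma quotX_off_axis n F p : smooth U F -> U p -> p.1 != 0 ->
  differentiable (quotX n F) p /\ forall v, 'D_v (quotX n F) p =
    v.1 * quotX n.+1 (euler_numerator n F) p + quotX n ('D_(0, v.2) F) p.
Proof.
move=> CF Up p0.
have dF := smooth_differentiable CF Up.
have [dr1 dr2] := is_derive_invX n p0.
have dr : differentiable (fun z : R => (z ^+ n)^-1) p.1 by exact/derivable1_diffP.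
have drf := is_diff_comp (is_diff_fst p) (differentiableP dr).
have dq := is_diffM (differentiableP dF) drf.
have qE : {near p, F * ((fun z : R => (z ^+ n)^-1) \o fst) =1 quotX n F}.
  have p0' : \forall q \near p, q.1 != 0.
    have /cvgrPdist_lt /(_ `|p.1|) : {for p, continuous (fst : R * W -> R)}.
      exact: cvg_fst.
    rewrite normr_gt0 => /(_ p0); apply: filterS => q.
    by apply: contraTneq => ->; rewrite subr0 ltxx.
  by apply: filterS p0' => q q0; rewrite /quotX (negbTE q0).
have := near_is_diff qE dq => dq'; split=> [|v]; first by have [] := dq'.
apply: (eq_trans (is_diff_derive v dq')).
rewrite -[LHS]/(F p * 'd (fun z : R => (z ^+ n)^-1) (p.1) (v.1) +
  (p.1 ^+ n)^-1 * 'd F p v).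
rewrite diff_real -(deriveE (1 : R) dr) dr2 -(deriveE v dF).
rewrite [v in 'D_v F p](surjective_pairing v) (derive_split _ _ dF).
rewrite /quotX (negbTE p0) -[euler_numerator n F p]/(p.1 * \d F p - n%:R * F p).
by rewrite exprS; field; rewrite p0 expf_neq0.
Qed.

(** On the axis the quotient is only known through its limits. Off the axis its
    [x]-derivative is [quotX n.+1 (euler_numerator n F)], which is continuous on the axis too,
    so by the mean value theorem the quotient has a continuous slope in [x]. *)
Lemma quotX_on_axis n F p : smooth U F -> vanishing n F -> U p -> p.1 = 0 ->
  differentiable (quotX n F) p /\ forall v, 'D_v (quotX n F) p =
    v.1 * quotX n.+1 (euler_numerator n F) p + quotX n ('D_(0, v.2) F) p.
Proof.
move=> CF vF Up p0.
have pE : p = (0, p.2) by rewrite -p0 -surjective_pairing.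
have CG : smooth U (euler_numerator n F) by exact: smooth_euler.
have vG : vanishing n.+1 (euler_numerator n F) by exact: vanishing_euler.
have qGc : {for p, continuous (quotX n.+1 (euler_numerator n F))}.
  by rewrite pE; apply: quotX_continuous_on_axis => //; rewrite -pE.
have [|k [kc kp kE]] := exists_slope (F := quotX n F) qGc.
  have nU : nbhs p U by exact: open_nbhs_nbhs.
  apply: filterS nU => -[x y] Uxy /=; rewrite p0 !subr0.
  have qc : {for (0 : R), continuous (fun z => quotX n F (z, y))}.
    by apply/continuous_line/quotX_continuous_on_axis => //; exact: (U0 Uxy).
  have [|z] := MVT_ball (x := x) (df := fun z => quotX n.+1 (euler_numerator n F) (z, y)) qc.
    move=> z z0; rewrite !subr0 => zx.
    have Uz : U (z, y) by exact: Ustar Uxy _.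
    have [dq Dq] := quotX_off_axis n CF Uz z0.
    have := is_derive_line dq; rewrite Dq mul1r /=.
    have -> : quotX n ('D_(0 : R * W) F) (z, y) = 0.
      by rewrite /quotX /= (negbTE z0) derive0 mul0r.
    by rewrite addr0.
  by rewrite !subr0 => zx ->; exists z; rewrite ?subr0.
pose I := iter n (fun F => \d F) F.
have CI : smooth U I by exact: smooth_iter.
have Up' : U (cst 0 p, p.2) by rewrite /= -pE.
have dI := smooth_differentiable CI Up'.
have di := is_diff_subst (f := cst 0) (differentiable_cst _ _) dI.
have df := is_diff_vanishing_mul (is_diff_fst p) p0 kc.
have dq := is_diffD (is_diffZ (n`!%:R^-1) di) df.
have qE : {near p, n`!%:R^-1 *: (fun q => I (cst 0 q, q.2)) + fst * k =1 quotX n F}.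
  by apply: filterS kE => q /= ->; rewrite p0 subr0 /quotX /= eqxx [X in _ = X + _]mulrC.
have := near_is_diff qE dq => dq'; split=> [|v]; first by have [] := dq'.
apply: (eq_trans (is_diff_derive v dq')).
have e : 'd (cst 0) p v = 0 :> R by exact: (congr1 (@^~ v) (diff_cst 0 p)).
suff E a : a = 0 -> n`!%:R^-1 * 'd I (0, p.2) (a, v.2) + k p * v.1 =
    v.1 * quotX n.+1 (euler_numerator n F) p + quotX n ('D_(0, v.2) F) p by exact: E.
move=> ->; rewrite -(deriveE _ dI) kp addrC; congr (_ + _); first exact: mulrC.
rewrite {1}/quotX p0 eqxx (iter_derive n v.2 CF Up'); exact: mulrC.
Qed.

(** The derivatives of [quotX n F] are combinations of quotients of the same kind,
    with numerators that vanish to the matching order. Hence the induction on the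
    class must treat all orders [n] and all numerators at once, although only
    [n = 1] is used below. *)
Lemma smooth_quotX n F : smooth U F -> vanishing n F -> smooth U (quotX n F).
Proof.
move=> + + k; elim: k n F => [|k IH] n F CF vF.
  move=> p Up; have [p0|p0] := eqVneq p.1 0.
    rewrite [p]surjective_pairing p0; apply: quotX_continuous_on_axis => //.
    exact: U0.
  have [dq _] := quotX_off_axis n CF Up p0; exact: differentiable_continuous.
have D p : U p -> differentiable (quotX n F) p /\ forall v, 'D_v (quotX n F) p =
    v.1 * quotX n.+1 (euler_numerator n F) p + quotX n ('D_(0, v.2) F) p.
  move=> Up; have [p0|p0] := eqVneq p.1 0; first exact: quotX_on_axis.
  exact: quotX_off_axis.
split=> [p Up|v]; first by have [] := D p Up.
apply: (@class_C_eq _ _ _ _ (v.1 *: quotX n.+1 (euler_numerator n F) +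
   quotX n ('D_(0, v.2) F))) => //.
  by move=> p Up; have [_ ->] := D p Up.
apply: class_CD => //.
  apply: class_CZ => //; apply: IH; first exact: smooth_euler.
  exact: vanishing_euler.
apply: IH; first exact: smooth_derive.
exact: vanishing_derive.
Qed.

Theorem hadamard F : smooth U F -> (forall p, U p -> F (0, p.2) = 0) ->
  exists2 h, smooth U h & forall p, U p -> F p = p.1 * h p.
Proof.
move=> CF F0; exists (quotX 1 F); first exact: smooth_quotX.
move=> p Up; rewrite /quotX.
have [p0|p0] := eqVneq p.1 0; last by rewrite mulrC divfK.
by rewrite p0 mul0r [p]surjective_pairing p0 F0.
Qed.

End Hadamard.

(** * Hyperbolic functions and the coordinate eta *)

Section HyperbolicFunctions.
Context {R : realType}.
Implicit Types m r s t c : R.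

Lemma coshR_gt0 t : 0 < coshR t.
Proof. by rewrite divr_gt0 // addr_gt0 // expR_gt0. Qed.

Lemma sinhR_lt_coshR t : sinhR t < coshR t.
Proof. by rewrite ltr_pM2r // ltrD2l gt0_cp // expR_gt0. Qed.

Lemma coshR2_sub_sinhR2 t : coshR t ^+ 2 - sinhR t ^+ 2 = 1.
Proof.
by rewrite -[RHS](expR0 R) -(subrr t) expRD /coshR /sinhR; field.
Qed.

Lemma one_sub_tanh_sqr t : 1 - (sinhR t / coshR t) ^+ 2 = (coshR t)^-1 ^+ 2.
Proof.
have c0 : coshR t != 0 by rewrite gt_eqF ?coshR_gt0.
have e : sinhR t ^+ 2 = coshR t ^+ 2 - 1.
  by rewrite -(coshR2_sub_sinhR2 t) opprB addrC subrK.
by rewrite expr_div_n e; field.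
Qed.

Lemma le_coshR c t : `|t| <= c -> coshR t <= coshR c.
Proof.
rewrite ler_norml => /andP[ct tc]; rewrite ler_pM2r //.
have h1 : 0 <= expR c - expR t by rewrite subr_ge0 ler_expR.
have h2 : 0 <= 1 - expR (- c) * expR (- t).
  by rewrite subr_ge0 -expRD -[leRHS](expR0 R) ler_expR; lra.
have := mulr_ge0 h1 h2.
have e1 : expR c * expR (- c) = 1 by rewrite -expRD subrr expR0.
have e2 : expR t * expR (- t) = 1 by rewrite -expRD subrr expR0.
have -> : (expR c - expR t) * (1 - expR (- c) * expR (- t)) =
  expR c - expR t - (expR c * expR (- c)) * expR (- t) +
  expR (- c) * (expR t * expR (- t)) by ring.
rewrite e1 e2; lra.
Qed.

Lemma le_sinhR_coshR c t : `|t| <= c -> `|sinhR t| <= sinhR c / coshR c * coshR t.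
Proof.
rewrite ler_norml => /andP[ct tc].
rewrite mulrAC ler_pdivlMr ?coshR_gt0 // -(gtr0_norm (coshR_gt0 c)) -normrM.
rewrite ler_norml.
have h1 : expR t <= expR c by rewrite ler_expR.
have h2 : expR (- c) <= expR (- t) by rewrite ler_expR lerN2.
have h3 : expR (- t) <= expR c by rewrite ler_expR; lra.
have h4 : expR (- c) <= expR t by rewrite ler_expR.
have := expR_gt0 t; have := expR_gt0 (- t); have := expR_gt0 (- c).
rewrite /sinhR /coshR => *; apply/andP; split; nra.
Qed.

Definition artanh (w : R) : R := 2^-1 * ln ((1 + w) * (1 - w)^-1).

Lemma artanhK t : artanh (sinhR t / coshR t) = t.
Proof.
have c0 : coshR t != 0 by rewrite gt_eqF ?coshR_gt0.
have d0 : coshR t - sinhR t != 0 by rewrite subr_eq0 gt_eqF ?sinhR_lt_coshR.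
rewrite /artanh; have -> : (1 + sinhR t / coshR t) * (1 - sinhR t / coshR t)^-1 =
    expR (t + t).
  have -> : (1 + sinhR t / coshR t) * (1 - sinhR t / coshR t)^-1 =
    (coshR t + sinhR t) / (coshR t - sinhR t) by field; rewrite c0 d0.
  apply/(canLR (mulfK _)) => //.
  have -> : coshR t + sinhR t = expR t by rewrite /coshR /sinhR; field.
  have -> : coshR t - sinhR t = expR (- t) by rewrite /coshR /sinhR; field.
  by rewrite -expRD addrK.
by rewrite expRK; field.
Qed.

Lemma smooth_idR (U : set R) : smooth U (@idfun R).
Proof.
case=> [x _|k]; first exact: cvg_id.
split=> [x _|v]; first exact: ex_diff.
have -> : 'D_v (@idfun R) = cst v by apply/funext => x; rewrite derive_id.
exact: class_C_cst.
Qed.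

Definition unit_itv : set R := [set s : R | -1 < s < 1].

Lemma open_unit_itv : open unit_itv.
Proof. exact: (@interval_open R (BRight (-1)) (BLeft 1)). Qed.

Lemma smooth_artanh : smooth unit_itv artanh.
Proof.
have o := open_unit_itv.
have id1 : smooth unit_itv (cst 1 + @idfun R).
  by apply: smoothD => //; [exact: smooth_cst|exact: smooth_idR].
have id2 : smooth unit_itv (cst 1 - @idfun R).
  by apply: smoothB => //; [exact: smooth_cst|exact: smooth_idR].
apply: (smoothM (f := cst 2^-1) o); first exact: smooth_cst.
apply: (smooth_comp (g := @ln R) o _ smooth_ln).
  by move=> w /= /andP[w1 w2]; rewrite mulr_gt0 ?invr_gt0 //; lra.
apply: smoothM => //; apply: (smooth_comp (g := GRing.inv) o _ smooth_inv id2).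
by move=> w /= /andP[w1 w2]; rewrite gt_eqF // subr_gt0.
Qed.

Definition radius_of_eta (m s : R) : R := 2 * m * (1 - s ^+ 2)^-1.

(** The hyperbolic radius [sqrt (X^2 - T^2)] of a point of Region I, in terms of
    [eta]. Unlike [sqrt (r / 2m - 1)], it extends smoothly across [eta = 0], as an
    odd function. *)
Definition hyperbolic_radius (s : R) : R :=
  s * (Num.sqrt (1 - s ^+ 2))^-1 * expR (2^-1 * (1 - s ^+ 2)^-1).

Lemma unit_itv_sqr s : unit_itv s -> 0 < 1 - s ^+ 2.
Proof. by move=> /andP[s1 s2]; nra. Qed.

Lemma smooth_one_sub_sqr : smooth unit_itv (fun s : R => 1 - s ^+ 2).
Proof.
apply: (smoothB (f := cst 1) open_unit_itv (@smooth_cst _ _ _ _)).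
by apply: (smoothM open_unit_itv); exact: smooth_idR.
Qed.

Lemma smooth_inv_one_sub_sqr : smooth unit_itv (fun s : R => (1 - s ^+ 2)^-1).
Proof.
apply: (smooth_comp (g := GRing.inv) open_unit_itv _ smooth_inv smooth_one_sub_sqr).
by move=> s /unit_itv_sqr s1; rewrite /= gt_eqF.
Qed.

Lemma smooth_radius_of_eta m : smooth unit_itv (radius_of_eta m).
Proof.
apply: (smoothM (f := cst (2 * m)) open_unit_itv); first exact: smooth_cst.
exact: smooth_inv_one_sub_sqr.
Qed.

Lemma smooth_hyperbolic_radius : smooth unit_itv hyperbolic_radius.
Proof.
have o := open_unit_itv; apply: (smoothM o); first apply: (smoothM o).
- exact: smooth_idR.
- apply: (smooth_comp (g := GRing.inv) o _ smooth_inv).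
    by move=> s /unit_itv_sqr s1; rewrite /= gt_eqF // sqrtr_gt0.
  apply: (smooth_comp (g := Num.sqrt) o _ smooth_sqrt smooth_one_sub_sqr).
  by move=> s /unit_itv_sqr.
- apply: (smooth_comp (g := expR) (D := setT) o _ smooth_expR) => //.
  apply: (smoothM (f := cst 2^-1) o); first exact: smooth_cst.
  exact: smooth_inv_one_sub_sqr.
Qed.

Lemma hyperbolic_radius0 : hyperbolic_radius 0 = 0.
Proof. by rewrite /hyperbolic_radius !mul0r. Qed.

Lemma hyperbolic_radius_gt0 s : 0 < s < 1 -> 0 < hyperbolic_radius s.
Proof.
move=> /andP[s0 s1]; rewrite !mulr_gt0 ?expR_gt0 // invr_gt0 sqrtr_gt0.
by apply: unit_itv_sqr; rewrite /unit_itv /= s1 andbT; lra.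
Qed.

Lemma hyperbolic_radiusE m s : 0 < m -> 0 <= s < 1 ->
  Num.sqrt (radius_of_eta m s / (2 * m) - 1) * expR (radius_of_eta m s / (4 * m)) =
  hyperbolic_radius s.
Proof.
move=> m0 /andP[s0 s1].
have d0 : 0 < 1 - s ^+ 2 by apply: unit_itv_sqr; rewrite /unit_itv /= s1 andbT; lra.
rewrite /radius_of_eta /hyperbolic_radius; congr (_ * expR _); last first.
  by field; rewrite !gt_eqF.
have -> : 2 * m * (1 - s ^+ 2)^-1 / (2 * m) - 1 = s ^+ 2 * (1 - s ^+ 2)^-1.
  by field; rewrite !gt_eqF.
by rewrite sqrtrM ?sqr_ge0 // sqrtr_sqr ger0_norm // sqrtrV // ltW.
Qed.

Lemma eta_coordK m r : 0 < m -> 2 * m < r -> radius_of_eta m (eta_coord m r) = r.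
Proof.
move=> m0 mr; have r0 : 0 < r by lra.
rewrite /radius_of_eta /eta_coord sqr_sqrtr.
  by field; rewrite !gt_eqF //; lra.
by rewrite subr_ge0 ler_pdivrMr // mul1r ltW.
Qed.

Lemma eta_coord_gt0 m r : 0 < m -> 2 * m < r -> 0 < eta_coord m r.
Proof.
move=> m0 mr; have r0 : 0 < r by lra.
by rewrite /eta_coord sqrtr_gt0 subr_gt0 ltr_pdivrMr // mul1r.
Qed.

Lemma eta_coord_lt1 m r : 0 < m -> 2 * m < r -> eta_coord m r < 1.
Proof.
move=> m0 mr; have r0 : 0 < r by lra.
rewrite /eta_coord -[X in _ < X]sqrtr1 ltr_sqrt // ltrBlDr ltrDl divr_gt0 //; lra.
Qed.

Lemma radius_of_eta_bounds m r1 s : 0 < m -> 2 * m < r1 ->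
  0 < s < eta_coord m r1 -> 2 * m < radius_of_eta m s < r1.
Proof.
move=> m0 mr1 /andP[s0 s1].
have e1 := eta_coord_lt1 m0 mr1.
have d0 : 0 < 1 - s ^+ 2.
  by apply: unit_itv_sqr; rewrite /unit_itv /= (lt_trans s1 e1) andbT; lra.
rewrite -(eta_coordK m0 mr1) /radius_of_eta.
have de : 0 < 1 - eta_coord m r1 ^+ 2.
  by apply: unit_itv_sqr; rewrite /unit_itv /= e1 andbT; lra.
apply/andP; split.
  have := mulr_gt0 m0 (exprn_gt0 2 s0); rewrite ltr_pdivlMr // mulrBr; lra.
by rewrite ltr_pM2l ?ltf_pV2 ?posrE //; nra.
Qed.

End HyperbolicFunctions.

(** * Smooth extension across the bifurcation sphere *)

Section SmoothOnSets.
Context {R : realType} {W : normedModType R}.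
Implicit Types (F : R * W -> R) (U : set (R * W)).

Lemma smooth_reparam (D : set R) (f : R -> R) U F : open U ->
  smooth D f -> smooth U F ->
  forall x0 y0, D x0 -> open D -> U (f x0, y0) ->
  exists e : R, [/\ 0 < e, (forall p, ball (x0, y0) e p -> U (f p.1, p.2)) &
    smooth (ball (x0, y0) e) (fun p => F (f p.1, p.2))].
Proof.
move=> Uo Df CF x0 y0 Dx0 Do Ux0.
have fc : {for (x0, y0), continuous (fun p : R * W => (f p.1, p.2))}.
  apply: (@cvg_pair _ _ _ (nbhs (x0, y0)) (nbhs (f x0)) (nbhs y0)).
    apply: (continuous_comp (f := fst)); first exact: cvg_fst.
    exact: smooth_continuous Df Dx0.
  exact: cvg_snd.
have nU : \forall p \near (x0, y0), U (f p.1, p.2).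
  by apply: fc; exact: open_nbhs_nbhs.
have nD : \forall p \near (x0, y0), D p.1.
  have fstc : {for (x0, y0), continuous (fst : R * W -> R)} by exact: cvg_fst.
  by apply: fstc; exact: open_nbhs_nbhs.
have : \forall p \near (x0, y0), D p.1 /\ U (f p.1, p.2).
  by apply: filterS2 nD nU => p.
move=> /nbhs_ballP[e /= e0 eU]; exists e; split=> //; first by move=> p /eU[].
have bo : open (ball (x0, y0) e) by exact: ball_open.
apply: (smooth_subst (f := f \o fst) (D := U) bo) => //.
  by move=> p /eU[].
apply: (smooth_comp (D := D) bo) => //; last exact: smooth_fst.
by move=> p /eU[].
Qed.

End SmoothOnSets.

Lemma half_lt {R : realType} (x : R) : 0 < x -> x / 2 < x.
Proof. by move=> x0; lra. Qed.

Section LocalExtension.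
Context {R : realType} {W : normedModType R}.
Variables (S : set W) (eps : R) (tau : R * W -> R).
Hypothesis eps0 : 0 < eps.
Hypothesis tau_smooth : smooth_on ([set X : R | `|X| < eps] `*` S) tau.

(** Points of the axis are limits of points where [|tau| <= k x], so [tau] vanishes
    on the axis and is [x] times a smooth function, which is bounded by [k < 1] on
    the axis and hence stays in [(-1, 1)] nearby. The smooth extension [F] of [tau]
    off [S] need not vanish on the axis, so Hadamard's lemma is applied to
    [F (x, y) - F (0, y)], which has the same values over [S]. *)
Lemma slope_extension (k : R) (y0 : W) : 0 <= k < 1 -> S y0 ->
  (forall y, S y -> forall d : R, 0 < d ->
    exists2 x, 0 < x < d & `|tau (x, y)| <= k * x) ->
  exists (e : R) (h : R * W -> R), [/\ 0 < e < eps, smooth (ball (0, y0) e) h,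
    forall p, ball (0, y0) e p -> -1 < h p < 1 &
    forall p, ball (0, y0) e p -> S p.2 -> tau p = p.1 * h p].
Proof.
move=> /andP[k0 k1] Sy0 small.
have Ay y : S y -> ([set X : R | `|X| < eps] `*` S) (0, y).
  by move=> Sy; split=> //=; rewrite normr0.
have [U [F [Uo Uy0 CF FE]]] := tau_smooth (Ay y0 Sy0).
have nU : nbhs (0 : R, y0) U by exact: open_nbhs_nbhs.
have /nbhs_ballP[d /= d0 dU] := nU.
pose e1 := Num.min d (eps / 2).
have e10 : 0 < e1 by rewrite lt_min d0 divr_gt0.
pose B := ball (0 : R, y0) e1.
have Bo : open B by exact: ball_open.
have BU : B `<=` U by apply: subset_trans dU; apply: le_ball; rewrite ge_min lexx.
have Beps p : B p -> `|p.1| < eps.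
  move=> [/= + _]; rewrite /ball /= sub0r normrN => /lt_trans; apply.
  by rewrite gt_min half_lt ?orbT.
have Bstar x z y : B (x, y) -> `|z| <= `|x| -> B (z, y).
  move=> [/= + By] zx; rewrite /ball /= sub0r normrN => xe1; split=> //=.
  by rewrite /ball /= sub0r normrN; exact: le_lt_trans xe1.
have B0 p : B p -> B (0, p.2).
  by case: p => x y Bp; apply: Bstar Bp _; rewrite normr0.
have FtauE p : B p -> S p.2 -> F p = tau p.
  by move=> Bp Sp; apply: FE; [exact: BU|split=> //; exact: Beps].
have CFB : smooth B F by exact: smooth_sub CF.
(* For arbitrarily small x > 0 both F (0, y) - F (x, y) and k x are small. *)
have F0 p : B p -> S p.2 -> F (0, p.2) = 0.
  move=> Bp Sp; have Bp0 := B0 p Bp.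
  apply/eqP; rewrite -normr_le0; apply/ler_addgt0Pr => r r0; rewrite add0r.
  have Fc : {for (0 : R, p.2), continuous F} by exact: smooth_continuous Bp0.
  have /cvgrPdist_lt /(_ (r / 2)) := Fc; rewrite divr_gt0 // => /(_ isT) Hr.
  have nB : nbhs (0 : R, p.2) B by exact: open_nbhs_nbhs.
  have : \forall q \near (0 : R, p.2), B q /\ `|F (0, p.2) - F q| < r / 2.
    by apply: filterS2 nB Hr => q.
  move=> /nbhs_ballP[d' /= d'0 H].
  have [|x /andP[x0 xd] taux] := small p.2 Sp (Num.min d' (r / 2)).
    by rewrite lt_min d'0 divr_gt0.
  move: xd; rewrite lt_min => /andP[xd xr].
  have [|Bx Fx] := H (x, p.2).
    by split=> //=; [rewrite /ball /= sub0r normrN gtr0_norm|exact: ballxx].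
  rewrite -FtauE // in taux.
  have := ler_normD (F (0, p.2) - F (x, p.2)) (F (x, p.2)); rewrite subrK; nra.
pose F1 := F - (fun p => F (cst 0 p, p.2)).
have CF1 : smooth B F1.
  apply: smoothB => //; apply: (smooth_subst (D := B) Bo) => //.
  exact: smooth_cst.
have [|h Ch hE] := hadamard Bo Bstar CF1.
  by move=> p Bp; rewrite /F1 !fctE subrr.
have tauE p : B p -> S p.2 -> tau p = p.1 * h p.
  move=> Bp Sp; rewrite -hE // -FtauE // /F1 -[RHS]/(F p - F (0, p.2)).
  by rewrite F0 // subr0.
have By0 : B (0, y0) by exact: ballxx.
have hc : {for (0, y0), continuous h} by exact: smooth_continuous By0.
have hk : `|h (0, y0)| <= k.
  apply/ler_addgt0Pr => r r0.
  have /cvgrPdist_lt /(_ r r0) Hr := hc.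
  have nB : nbhs (0 : R, y0) B by exact: open_nbhs_nbhs.
  have : \forall q \near (0 : R, y0), B q /\ `|h (0, y0) - h q| < r.
    by apply: filterS2 nB Hr => q.
  move=> /nbhs_ballP[d' /= d'0 H].
  have [x /andP[x0 xd]] := small y0 Sy0 d' d'0.
  have [|Bx hx] := H (x, y0).
    by split=> //=; [rewrite /ball /= sub0r normrN gtr0_norm|exact: ballxx].
  rewrite tauE // normrM gtr0_norm // mulrC ler_pM2r // => hxk.
  have := ler_normD (h (0, y0) - h (x, y0)) (h (x, y0)); rewrite subrK; lra.
have nh : \forall p \near (0 : R, y0), -1 < h p < 1.
  have /cvgrPdist_lt /(_ (1 - k)) := hc; rewrite subr_gt0 => /(_ k1).
  apply: filterS => p; rewrite -ltr_norml.
  by have := ler_distD (h (0, y0)) 0 (h p); rewrite !sub0r !normrN; lra.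
have nB : nbhs (0 : R, y0) B by exact: open_nbhs_nbhs.
have : \forall p \near (0 : R, y0), B p /\ -1 < h p < 1.
  by apply: filterS2 nB nh => p.
move=> /nbhs_ballP[e /= e0 He].
exists (Num.min e (eps / 2)), h.
have bsub : ball (0 : R, y0) (Num.min e (eps / 2)) `<=` ball (0 : R, y0) e.
  by apply: le_ball; rewrite ge_min lexx.
split.
- by rewrite lt_min e0 divr_gt0 //= gt_min half_lt ?orbT.
- by apply: smooth_sub Ch => p /bsub /He[].
- by move=> p /bsub /He[].
- by move=> p /bsub /He[Bp _]; exact: tauE.
Qed.

(** Write [tau = x h]. A point [(a sinh t, a cosh t)] on the graph has
    [h = tanh t] and therefore [a = x sqrt (1 - h^2)]. The right-hand side has a
    positive [x]-derivative at [x = 0], so [x] is a smooth function of [(a, y)],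
    and then so is [t = artanh (h (x, y))]. *)
Lemma rapidity_extension (k : R) (y0 : W) : 0 <= k < 1 -> S y0 ->
  (forall y, S y -> forall d : R, 0 < d ->
    exists2 x, 0 < x < d & `|tau (x, y)| <= k * x) ->
  exists (e d : R) (G : R * W -> R), [/\ 0 < e, 0 < d < eps,
    smooth (ball (0, y0) e) G &
    forall (a t : R) (y : W), ball (0, y0) e (a, y) -> S y -> 0 < a -> a * coshR t <= d ->
      tau (a * coshR t, y) = a * sinhR t -> G (a, y) = t].
Proof.
move=> k01 Sy0 small.
have [e [h [/andP[e0 eeps] Ch h1 tauE]]] := slope_extension k01 Sy0 small.
pose B := ball (0 : R, y0) e.
have Bo : open B by exact: ball_open.
have By0 : B (0, y0) by exact: ballxx.
pose q := cst 1 - h * h.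
have qE p : q p = 1 - h p ^+ 2 by [].
have q0 p : B p -> 0 < q p by move=> /h1 hp; rewrite qE; exact: unit_itv_sqr.
have Cq : smooth B q.
  by apply: smoothB => //; [exact: smooth_cst|exact: smoothM].
have Csq : smooth B (Num.sqrt \o q).
  by apply: (smooth_comp (D := [set x | 0 < x]) Bo) => //; exact: smooth_sqrt.
pose Phi : R * W -> R := fst * (Num.sqrt \o q).
have CPhi : smooth B Phi by apply: smoothM => //; exact: smooth_fst.
have dPhi : 0 < 'D_(1, 0) Phi (0, y0).
  rewrite /Phi deriveM.
  - rewrite derive_fst -[X in 0 < X]/(0 * _ + Num.sqrt (q (0, y0)) * 1).
    by rewrite mul0r add0r mulr1 sqrtr_gt0 q0.
  - by apply: diff_derivable; have [] := is_diff_fst (0 : R, y0).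
  - by apply: diff_derivable; exact: smooth_differentiable By0.
have [d [N [Psi [d0 [No Ny0] CPsi PsiB PsiK]]]] :=
  smooth_local_inverse Bo By0 CPhi dPhi.
have Phi0 : Phi (0, y0) = 0 by rewrite /Phi -[LHS]/(0 * _) mul0r.
rewrite Phi0 in Ny0.
have /nbhs_ballP[e' /= e'0 e'N] : nbhs (0 : R, y0) N by exact: open_nbhs_nbhs.
pose G := artanh \o (fun p => h (Psi p, p.2)).
have CG : smooth N G.
  apply: (smooth_comp (D := unit_itv) No _ smooth_artanh).
    by move=> p Np; apply: h1; exact: PsiB.
  exact: (smooth_subst (D := B)).
pose d' := Num.min d (e / 2).
exists (Num.min e' e), d', G; split.
- by rewrite lt_min e'0.
- by rewrite lt_min d0 divr_gt0 //= gt_min (lt_trans (half_lt e0) eeps) orbT.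
- by apply: smooth_sub CG; apply: subset_trans e'N; apply: le_ball; rewrite ge_min lexx.
- move=> a t y ay Sy a0; set X := a * coshR t => Xd tX.
  have c0 := coshR_gt0 t.
  have X0 : 0 < X by rewrite mulr_gt0.
  have ye : ball y0 e y by have [_] := ay; apply: le_ball; rewrite ge_min lexx orbT.
  have Nay : N (a, y) by apply: e'N; apply: le_ball ay; rewrite ge_min lexx.
  have BX : B (X, y).
    split=> //=; rewrite /ball /= sub0r normrN gtr0_norm //.
    by apply: (le_lt_trans Xd); rewrite gt_min half_lt ?orbT.
  have hE : h (X, y) = sinhR t / coshR t.
    have := tauE _ BX Sy; rewrite tX /= => E.
    have Xn0 : X != 0 by rewrite gt_eqF.
    apply: (mulfI Xn0); rewrite -E /X; field; by rewrite gt_eqF.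
  have PhiE : Phi (X, y) = a.
    rewrite /Phi -[LHS]/(X * Num.sqrt (1 - h (X, y) ^+ 2)) hE.
    by rewrite one_sub_tanh_sqr sqrtr_sqr ger0_norm ?invr_ge0 ?ltW // /X mulfK // gt_eqF.
  have PsiX : Psi (a, y) = X.
    rewrite -{1}PhiE; apply: PsiK; last by rewrite PhiE.
    by rewrite subr0 gtr0_norm // (le_trans Xd) // ge_min lexx.
  by rewrite /G /= PsiX hE artanhK.
Qed.

End LocalExtension.

Section Extension.
Context {R : realType}.
Variables (m r1 C eps : R) (u tau : R * 'rV[R]_3 -> R).
Hypotheses (m_gt0 : 0 < m) (r1_gt : 2 * m < r1) (eps_gt0 : 0 < eps).
Hypothesis u_le : forall p, graph_domain m r1 p -> `|u p| <= C.
Hypothesis tau_smooth : smooth_on ([set X : R | `|X| < eps] `*` sphere2) tau.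
Hypothesis Sigma_sub : schwarzschild_graph m r1 u `&` [set p | p.1.2 < eps]
  `<=` kruskal_graph eps tau.

Let eta1 := eta_coord m r1.
Let c := `|C| / (4 * m).
Let rapidity s y := u (radius_of_eta m s, y) / (4 * m).

Let m4 : 0 < 4 * m. Proof. by rewrite mulr_gt0. Qed.

Lemma graph_domain_eta s y : 0 < s < eta1 -> sphere2 y ->
  graph_domain m r1 (radius_of_eta m s, y).
Proof. by move=> se Sy; split=> //=; exact: radius_of_eta_bounds. Qed.

Lemma rapidity_le s y : 0 < s < eta1 -> sphere2 y -> `|rapidity s y| <= c.
Proof.
move=> se Sy; rewrite /rapidity /c normrM normfV (gtr0_norm m4).
rewrite ler_pM2r ?invr_gt0 //; apply: le_trans (ler_norm C).
exact/u_le/graph_domain_eta.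
Qed.

Lemma tau_on_Sigma s y : 0 < s < eta1 -> sphere2 y ->
  hyperbolic_radius s * coshR (rapidity s y) < eps ->
  tau (hyperbolic_radius s * coshR (rapidity s y), y) =
  hyperbolic_radius s * sinhR (rapidity s y).
Proof.
move=> se Sy Xeps; have [s0 s1] := andP se.
have sE := hyperbolic_radiusE m_gt0 (s := s).
pose p : kcoord := ((hyperbolic_radius s * sinhR (rapidity s y),
  hyperbolic_radius s * coshR (rapidity s y)), y).
have Sp : schwarzschild_graph m r1 u p.
  exists (radius_of_eta m s, y); first exact: graph_domain_eta.
  rewrite /region_I_embedding sE //= (ltW s0) (lt_trans s1) //.
  exact: eta_coord_lt1.
have [[X y'] _ /= [TE XE yE]] := Sigma_sub (conj Sp Xeps : _ p).
by rewrite XE yE in TE.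
Qed.

Lemma hyperbolic_radius_small (d : R) : 0 < d ->
  exists2 e : R, 0 < e & forall s, 0 < s < e -> hyperbolic_radius s * coshR c < d.
Proof.
move=> d0; have u0 : unit_itv (0 : R) by rewrite /unit_itv /=; lra.
have sc := smooth_continuous (@smooth_hyperbolic_radius R) u0.
have dc : 0 < d / coshR c by rewrite divr_gt0 ?coshR_gt0.
have /cvgrPdist_lt /(_ _ dc) := sc.
rewrite hyperbolic_radius0 => /nbhs_ballP[e /= e0 H]; exists e => // s /andP[s0 se].
have /H : ball (0 : R) e s by rewrite /ball /= sub0r normrN gtr0_norm.
rewrite /= sub0r normrN ltr_pdivlMr ?coshR_gt0 //; apply: le_lt_trans.
by rewrite ler_wpM2r ?ler_norm // ltW ?coshR_gt0.
Qed.

Lemma graph_X_bounds s y : 0 < s < eta1 -> sphere2 y ->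
  0 < hyperbolic_radius s * coshR (rapidity s y) <= hyperbolic_radius s * coshR c.
Proof.
move=> se Sy; have [s0 s1] := andP se.
have a0 : 0 < hyperbolic_radius s.
  by apply: hyperbolic_radius_gt0; rewrite s0 (lt_trans s1) //; exact: eta_coord_lt1.
by rewrite mulr_gt0 ?coshR_gt0 // ler_pM2l // le_coshR // rapidity_le.
Qed.

(** [T / X = tanh (t / 4m)] is bounded away from [1] because [t] is, and points of
    the graph with arbitrarily small [X] are obtained by letting [eta] tend to
    [0]. *)
Lemma tau_small y : sphere2 y -> forall d : R, 0 < d ->
  exists2 x, 0 < x < d & `|tau (x, y)| <= sinhR c / coshR c * x.
Proof.
move=> Sy d d0.
have [|e e0 He] := @hyperbolic_radius_small (Num.min d eps); first by rewrite lt_min d0.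
pose s := Num.min e eta1 / 2.
have eta10 : 0 < eta1 by exact: eta_coord_gt0.
have min0 : 0 < Num.min e eta1 by rewrite lt_min e0.
have s0 : 0 < s by rewrite divr_gt0.
have se : 0 < s < e by rewrite s0 (lt_le_trans (half_lt min0)) // ge_min lexx.
have s1 : 0 < s < eta1.
  by rewrite s0 (lt_le_trans (half_lt min0)) // ge_min lexx orbT.
have /andP[X0 Xle] := graph_X_bounds s1 Sy.
have := le_lt_trans Xle (He s se); rewrite lt_min => /andP[Xd Xeps].
exists (hyperbolic_radius s * coshR (rapidity s y)); first by rewrite X0.
have a0 : 0 < hyperbolic_radius s by move: X0; rewrite pmulr_lgt0 ?coshR_gt0.
rewrite tau_on_Sigma // normrM (gtr0_norm a0) mulrCA ler_pM2l //.
by apply: le_sinhR_coshR; exact: rapidity_le.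
Qed.

Lemma local_extension y0 : sphere2 y0 ->
  exists (e : R) (F : R * 'rV[R]_3 -> R), [/\ 0 < e, smooth (ball (0, y0) e) F &
    forall (s : R) (y : 'rV[R]_3), ball (0, y0) e (s, y) -> sphere2 y -> 0 < s < eta1 ->
      F (s, y) = u (radius_of_eta m s, y)].
Proof.
move=> Sy0.
have k01 : 0 <= sinhR c / coshR c < 1.
  rewrite ltr_pdivrMr ?coshR_gt0 // mul1r sinhR_lt_coshR andbT.
  rewrite divr_ge0 // ?(ltW (coshR_gt0 _)) // /sinhR divr_ge0 // subr_ge0 ler_expR.
  have c0 : 0 <= c by rewrite divr_ge0 // ltW.
  lra.
have [e [d [G [e0 /andP[d0 deps] CG GE]]]] :=
  rapidity_extension eps_gt0 tau_smooth k01 Sy0 tau_small.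
have bo : open (ball (0 : R, y0) e) by exact: ball_open.
have u0 : unit_itv (0 : R) by rewrite /unit_itv /=; lra.
have [|e' [e'0 e'P CF]] :=
    smooth_reparam bo smooth_hyperbolic_radius CG u0 open_unit_itv (y0 := y0).
  by rewrite hyperbolic_radius0; exact: ballxx.
have [f f0 fP] := hyperbolic_radius_small d0.
have sub : ball (0 : R, y0) (Num.min e' f) `<=` ball (0 : R, y0) e'.
  by apply: le_ball; rewrite ge_min lexx.
exists (Num.min e' f), ((4 * m) *: (fun p => G (hyperbolic_radius p.1, p.2))); split.
- by rewrite lt_min e'0.
- apply: smoothM; [exact: ball_open|exact: (@smooth_cst _ _ _ (4 * m))|].
  exact: smooth_sub CF.
- move=> s y bsy Sy s1; have [s0 _] := andP s1.
  have sf : 0 < s < f.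
    rewrite s0 /=; have [/= + _] := bsy; rewrite /ball /= sub0r normrN gtr0_norm //.
    by rewrite lt_min => /andP[].
  have bG := e'P _ (sub _ bsy).
  have /andP[X0 Xle] := graph_X_bounds s1 Sy.
  have Xd := ltW (le_lt_trans Xle (fP s sf)).
  have a0 : 0 < hyperbolic_radius s by move: X0; rewrite pmulr_lgt0 ?coshR_gt0.
  rewrite -[LHS]/(4 * m * G (hyperbolic_radius s, y)).
  rewrite (GE _ (rapidity s y)) // /rapidity; first by field; rewrite gt_eqF.
  by apply: tau_on_Sigma => //; exact: le_lt_trans deps.
Qed.

End Extension.

Theorem proposition4p1 (R : realType) (m r1 : R) (u : R * 'rV[R]_3 -> R)
  (m_gt0 : 0 < m) (r1_gt : 2 * m < r1)
  (u_smooth : smooth_on (graph_domain m r1) u)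
  (u_bounded : exists C : R, forall p, graph_domain m r1 p -> `|u p| <= C)
  (Sigma_spacelike : spacelike m (schwarzschild_graph m r1 u))
  (Sigma_extends : extends_through_bifurcation m (schwarzschild_graph m r1 u)) :
  exists (eta0 : R) (U : R * 'rV[R]_3 -> R),
    [/\ 0 < eta0,
        smooth_on ([set s : R | 0 <= s < eta0] `*` sphere2) U &
        forall r y, graph_domain m r1 (r, y) -> eta_coord m r < eta0 ->
          U (eta_coord m r, y) = u (r, y)].
Proof.
have [C u_le] := u_bounded.
have [eps [tau [eps_gt0 tau_smooth _ _ Sigma_sub]]] := Sigma_extends.
have ext := local_extension m_gt0 r1_gt eps_gt0 u_le tau_smooth Sigma_sub.
pose eta1 := eta_coord m r1.
have eta1_gt0 : 0 < eta1 by exact: eta_coord_gt0.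
have eta1_lt1 : eta1 < 1 by exact: eta_coord_lt1.
pose U p := if 0 < p.1 then u (radius_of_eta m p.1, p.2)
  else lim (u (radius_of_eta m s, p.2) @[s --> (0 : R)^'+]).
exists eta1, U; split=> //; last first.
  move=> r y [/= /andP[mr rr1] Sy] _.
  by rewrite /U /= eta_coord_gt0 // eta_coordK.
move=> [s0 y0] [/= /andP[s00 s01] Sy0].
have [s0E|s0_gt0] : s0 = 0 \/ 0 < s0.
  by move: s00; rewrite le_eqVlt => /orP[/eqP <-|]; [left|right].
- have [e [F [e0 CF FE]]] := ext y0 Sy0.
  exists (ball (0 : R, y0) e), F; rewrite s0E; split=> //.
  + exact: ball_open.
  + exact: ballxx.
  move=> [x y] bxy [/= /andP[x0 x1] Sy]; rewrite /U /=.
  have [xE|x_gt0] : x = 0 \/ 0 < x.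
    by move: x0; rewrite le_eqVlt => /orP[/eqP <-|]; [left|right].
    rewrite xE ltxx; apply/esym/cvg_lim => //.
    have bo : open (ball (0 : R, y0) e) by exact: ball_open.
    rewrite xE in bxy.
    have Fc : {for (0 : R), continuous (fun s => F (s, y))}.
      exact/continuous_line/(smooth_continuous CF bxy).
    have Fr : F (s, y) @[s --> (0 : R)^'+] --> F (0, y) by exact: cvg_at_right_filter.
    apply: cvg_trans Fr; apply: near_eq_cvg; near=> s.
    apply: FE => //; last first.
      apply/andP; split; near: s; [exact: nbhs_right_gt|exact: nbhs_right_lt].
    have [_ by0] := bxy; split=> //=.
    have s_gt0 : 0 < s by near: s; exact: nbhs_right_gt.
    by rewrite /ball /= sub0r normrN gtr0_norm //; near: s; exact: nbhs_right_lt.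
  by rewrite x_gt0; apply: FE => //; rewrite x_gt0.
(* Where eta > 0, u is smooth by assumption and r is a smooth function of eta; the
   radius of the ball is at most s0 to stay away from eta = 0. *)
- have s01' : 0 < s0 < eta1 by rewrite s0_gt0.
  have [Uu [Fu [Uuo Uus CFu FuE]]] :=
    u_smooth _ (graph_domain_eta m_gt0 r1_gt s01' Sy0).
  have su : unit_itv s0 by rewrite /unit_itv /= (lt_trans s01) // andbT; lra.
  have [e [e0 eP CF]] :=
    smooth_reparam Uuo (@smooth_radius_of_eta _ m) CFu su open_unit_itv Uus.
  have sub : ball (s0, y0) (Num.min e s0) `<=` ball (s0, y0) e.
    by apply: le_ball; rewrite ge_min lexx.
  exists (ball (s0, y0) (Num.min e s0)), (fun p => Fu (radius_of_eta m p.1, p.2)).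
  split=> //.
  + exact: ball_open.
  + by apply: ballxx; rewrite lt_min e0.
  + exact: (smooth_sub sub CF).
  move=> [x y] bxy [/= /andP[x0 x1] Sy].
  have x_gt0 : 0 < x.
    have [/= + _] := bxy; rewrite /ball /= lt_min => /andP[_].
    by rewrite ltr_norml => /andP[_]; lra.
  have Ux := eP _ (sub _ bxy).
  rewrite /U /= x_gt0; apply: FuE => //; apply: graph_domain_eta => //.
  by rewrite x_gt0.
Unshelve. all: by end_near. Qed.
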